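(* Let $\widehat\pi=\{\pi_t\}_{t=1}^T$ be the (random) policy sequence generated by the algorithm SubMAPL with constant step size $\eta>0$ in the open multi-agent Markov decision process described in the context. Assume: (1) for every $t\in[T]$ and every state $s\in\mathcal S$, the set function $F_t(\cdot;s):2^{\Omega_t}\to\mathbb R_{\ge 0}$ is normalized, monotone and submodular, and $\mathcal A_i\neq\emptyset$ for all $i\in\mathcal N_t$; (2) there is a constant $B<\infty$ such that $0\le F_t(e\mid A;s)\le B$ for all $t\in[T]$, all $s\in\mathcal S$, all $A\subseteq\Omega_t$ and all $e\in\Omega_t\setminus A$; (3) (time-expanded submodular utility) there exist a policy-independent finite ground set $\bar\Omega_{1:T}$, policy-independent families $\bar{\mathcal I}_t\subseteq 2^{\bar\Omega_{1:T}}$ ($t\in[T]$), and a normalized, monotone, submodular function $\bar F:2^{\bar\Omega_{1:T}}\to\mathbb R_{\ge0}$ such that, for every feasible execution and every $t\in[T]$: each $A\in\mathcal I_t$ corresponds to a time-expanded set $\bar A\in\bar{\mathcal I}_t$, and every element of $\bar{\mathcal I}_t$ corresponds to some $A\in\mathcal I_t$ in this way; the state $s_t$ contains (determines) the accumulated history $\bar A_{1:t-1}=\bigcup_{k=1}^{t-1}\bar A_k$ of the time-expanded sets of the executed actions $A_1,\dots,A_{t-1}$; and for every $A\in\mathcal I_t$, $F_t(A;s_t)=\bar F(\bar A_{1:t-1}\cup\bar A)-\bar F(\bar A_{1:t-1})$. Then $$J(\widehat\pi)\ \ge\ \frac13 J^\star-\frac23\,\mathcal C_T,\qquad\text{where}\quad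 \mathcal C_T=\frac{\mathbb E_{s_1\sim\mu_1}\big[D_{\mathrm{KL},1}(\pi_1^\star\Vert\pi_1)\big]+\mathcal V_T^{\mathrm{open}}}{2\eta}+\frac{\eta\,T\,N_{\max}B^2}{4}.$$
   Context: Open multi-agent MDP. $T\in\mathbb N$, $[T]=\{1,\dots,T\}$. $(\mathcal N_t)_{t\in[T]}$ is an exogenously given sequence of finite sets of active agents (not influenced by the policies or the state transitions), $\mathcal N_0=\emptyset$, $N_{\max}=\max_{t}|\mathcal N_t|$. Each agent $i$ has a finite action set $\mathcal A_i$ and a finite observation space $\mathcal O_i$. $\mathcal S$ is the state space, $\mu_1$ the initial distribution on $\mathcal S$, $O_{i,t}:\mathcal S\to\mathcal O_i$ deterministic observation maps with $o_{i,t}=O_{i,t}(s_t)$, and $P_t(\cdot\mid s,\mathbf a)$ transition kernels, $s_{t+1}\sim P_t(\cdot\mid s_t,\mathbf a_t)$, $\mathbf a_t=(a_{i,t})_{i\in\mathcal N_t}$. (All functions of the state are assumed measurable where needed.) Put $\Omega_t=\{(i,a):i\in\mathcal N_t,a\in\mathcal A_i\}$, $\Omega_{i,t}=\{(i,a):a\in\mathcal A_i\}$, $\mathcal I_t=\{A\subseteq\Omega_t:|A\cap\Omega_{i,t}|\le1\ \forall i\in\mathcal N_t\}$. The executed set is $A_t=\{(i,a_{i,t}):i\in\mathcal N_t\}\in\mathcal I_t$. A feasible execution is a trajectory $(s_1,\mathbf a_1,\dots,s_T,\mathbf a_T)$ arising from admissible action choices $a_{i,t}\in\mathcal A_i$ and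 the dynamics $\mu_1,(P_t)$. $F_t(\cdot;s):2^{\Omega_t}\to\mathbb R_{\ge0}$ is the stage utility, with marginal gain $F_t(e\mid A;s)=F_t(A\cup\{e\};s)-F_t(A;s)$. A set function $F$ is normalized if $F(\emptyset)=0$, monotone if $A\subseteq A'\Rightarrow F(A)\le F(A')$, submodular if $F(e\mid A)\ge F(e\mid A')$ for $A\subseteq A'$, $e\notin A'$, where $F(e\mid A)=F(A\cup\{e\})-F(A)$. $[z]_+=\max\{z,0\}$. Objective. A local policy $\pi^i$ assigns to each $o\in\mathcal O_i$ a probability distribution $\pi^i(\cdot\mid o)$ on $\mathcal A_i$; given local policies, the decentralized factorized policy sequence is $\pi=\{\pi_t\}_{t=1}^T$, $\pi_t(\mathbf a_t\mid\mathbf o_t)=\prod_{i\in\mathcal N_t}\pi^i(a_{i,t}\mid o_{i,t})$ (actions sampled independently across agents). $p^\pi$ is the induced law of $\tau=(s_1,\mathbf a_1,\dots,s_T,\mathbf a_T,s_{T+1})$, $J(\pi)=\mathbb E_{\tau\sim p^\pi}[\sum_{t=1}^TF_t(A_t;s_t)]$, and $J^\star=\max_\pi J(\pi)$ over such policy sequences. Similarly $J(\widehat\pi)=\mathbb E_{\tau\sim p^{\widehat\pi}}[\sum_{t=1}^T F_t(A_t;s_t)]$, where $p^{\widehat\pi}$ is the law of the process generated by SubMAPL below. SubMAPL. Each active agent $i$ keeps logits $\theta^i(o,a)\in\mathbb R$, $o\in\mathcal O_i$, $a\in\mathcal A_i$; its policy is $\pi^i(a\mid o)=e^{\theta^i(o,a)}/\sum_{b\in\mathcal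 A_i}e^{\theta^i(o,b)}$. Initially (agents in $\mathcal N_1$) the logits are given finite values $\theta^{i,0}$. At time $t$, with current policy $\pi_t$ (local policies $\pi^i$, $i\in\mathcal N_t$): every $i\in\mathcal N_t$ observes $o_{i,t}$ and independently samples $a_{i,t}\sim\pi^i(\cdot\mid o_{i,t})$; set $A_t^{-i}=A_t\setminus\{(i,a_{i,t})\}$ and $\widehat g_{i,a,t}=F_t((i,a)\mid A_t^{-i};s_t)$ for all $a\in\mathcal A_i$; the logits are updated by $\theta^{i,+}(o_{i,t},a)=\theta^i(o_{i,t},a)+\eta\widehat g_{i,a,t}$, all other entries unchanged, giving the post-update policy $\pi_t^+$ (local policies $\pi^{i,+}$); then $s_{t+1}\sim P_t(\cdot\mid s_t,\mathbf a_t)$. Migration: $\pi_{t+1}$ has local policies $\pi^{i,+}$ for $i\in\mathcal N_{t+1}\cap\mathcal N_t$ and $\pi^{i,0}$ (softmax of given finite logits $\theta^{i,0}$) for $i\in\mathcal N_{t+1}\setminus\mathcal N_t$; departing agents are dropped. Stagewise comparator. $\mathcal F_t=\{x\in[0,1]^{\Omega_t}:\sum_{a\in\mathcal A_i}x_{(i,a)}=1\ \forall i\in\mathcal N_t\}$. For $x\in\mathcal F_t$, $\tilde f_t(x;s)=\mathbb E[F_t(A;s)]$ where $A$ contains exactly one element of each $\Omega_{i,t}$, equal to $(i,a)$ with probability $x_{(i,a)}$, independently over $i\in\mathcal N_t$. $x_t^\star\in\arg\max_{x\in\mathcal F_t}\tilde f_t(x;s_t)$ is a (measurable) selection determined by $t$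 and $s_t$. $\pi_t^\star$ is the tabular policy with $(\pi_t^\star)^i(a\mid o_{i,t})=x^\star_{(i,a),t}$ and $(\pi_t^\star)^i(\cdot\mid o)=\pi^i(\cdot\mid o)$ (the local policy of $\pi_t$) for $o\ne o_{i,t}$. KL quantities. $D_{\mathrm{KL}}(p\Vert q)=\sum_a p_a\log(p_a/q_a)$ with $0\log(0/q)=0$; for tabular policies $\pi,\pi'$ on $\mathcal N_t$, $D_{\mathrm{KL},t}(\pi\Vert\pi')=\sum_{i\in\mathcal N_t}\sum_{o\in\mathcal O_i}D_{\mathrm{KL}}(\pi^i(\cdot\mid o)\Vert\pi'^i(\cdot\mid o))$. The open-system KL tracking variation is $$\mathcal V_T^{\mathrm{open}}=\mathbb E_{\tau\sim p^{\widehat\pi}}\Big[\sum_{t=1}^{T-1}\big[D_{\mathrm{KL},t+1}(\pi_{t+1}^\star\Vert\pi_{t+1})-D_{\mathrm{KL},t}(\pi_t^\star\Vert\pi_t^+)\big]_+\Big].$$ *)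

(* Defs.v *)
From HB Require Import structures.
From mathcomp Require Import all_boot all_order all_algebra.
From mathcomp Require Import all_classical all_reals all_analysis.

Set Implicit Arguments.
Unset Strict Implicit.
Unset Printing Implicit Defensive.
Import Order.TTheory GRing.Theory Num.Theory.

Local Open Scope classical_set_scope.
Local Open Scope ring_scope.

(** ** Set functions *)

Section SetFunctions.
Context {R : realType} {U : finType}.
Implicit Types (f : {set U} -> R) (D X Y : {set U}).

Definition marginal f (e : U) X : R := f (e |: X)%SET - f X.

Definition normalized f : Prop := f finset.set0 = 0.

(* [D] is the ground set: only the values of [f] on subsets of [D] matter. *)
Definition monotone_on D f : Prop :=
  forall X Y, X \subset Y -> Y \subset D -> f X <= f Y.

Definition submodular_on D f : Prop :=
  forall X Y e, X \subset Y -> Y \subset D -> e \in D -> e \notin Y ->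
    marginal f e Y <= marginal f e X.

End SetFunctions.

(** ** Joint actions and trajectories *)

Definition pairs (I : finType) (A : I -> finType) : finType := {i : I & A i}.

(* A joint action [(a_i)_(i in N_t)] is identified with its executed set
   [{(i, a_i) | i in N_t}]; this gives joint actions a type independent of [t].
   The admissible ones at time [t] are the members of [joint_actions M t]. *)
Definition jaction (I : finType) (A : I -> finType) := {set pairs A}.

HB.instance Definition _ (I : finType) (A : I -> finType) :=
  Finite.on (jaction A).
HB.instance Definition _ (I : finType) (A : I -> finType) :=
  isPointed.Build (jaction A) finset.set0.
HB.instance Definition _ (I : finType) (A : I -> finType) :=
  @isMeasurable.Build default_measure_display (jaction A)
    discrete_measurable discrete_measurable0
    discrete_measurableC discrete_measurableU.

(* [(s_1, a_1, ..., s_n, a_n, s_(n+1))], the pairs [(s_t, a_t)] being stored in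
   the tuple and the last state apart *)
Definition traj d (S : measurableType d) (I : finType) (A : I -> finType)
  (n : nat) := (n.-tuple (S * jaction A) * S)%type.

Section Trajectories.
Context d (S : measurableType d) (I : finType) (A : I -> finType).
Implicit Types n t : nat.

(* [s_t] for [1 <= t <= n + 1] *)
Definition state_at n (tau : traj S A n) t : S :=
  nth tau.2 (map fst tau.1) t.-1.

(* the executed set [A_t] for [1 <= t <= n] *)
Definition action_at n (tau : traj S A n) t : jaction A :=
  nth finset.set0 (map snd tau.1) t.-1.

Definition start (s : S) : traj S A 0 := ([tuple], s).

Definition extend n (h : traj S A n) (X : jaction A) (s : S) : traj S A n.+1 :=
  (rcons_tuple h.1 (h.2, X), s).

End Trajectories.

(** ** Open multi-agent MDPs *)

(* The agents occurring over the finite horizon form the finite type [I]. Times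
   are [1, ..., horizon]; the components are total functions of time, their
   values at other times (except [active 0]), and those of [utility] on sets not
   included in [ground t], being irrelevant. *)
Record openMDP (R : realType) d (S : measurableType d)
    (I : finType) (A O : I -> finType) := OpenMDP {
  horizon : nat ;
  horizon_gt0 : (0 < horizon)%N ;
  active : nat -> {set I} ;
  active0 : active 0 = finset.set0 ;
  init : probability S R ;
  obs : nat -> forall i : I, S -> O i ;
  measurable_obs : forall t i o, measurable [set s | obs t i s = o] ;
  trans : nat -> jaction A -> R.-pker S ~> S ;
  utility : nat -> {set pairs A} -> S -> R ;
  measurable_utility : forall t X, measurable_fun setT (utility t X) ;
  utility_ge0 : forall t X s, 0 <= utility t X s }.

Section OpenMDP.
Context {R : realType} {d : measure_display} {S : measurableType d}.
Context {I : finType} {A O : I -> finType} (M : openMDP R S A O).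
Implicit Types (n t : nat) (s : S) (X : jaction A).

Local Notation T := (horizon M).

Definition in_horizon t : bool := (1 <= t <= T)%N.

Definition ground t : {set pairs A} :=
  [set e : pairs A | tag e \in active M t]%SET.

Definition ground_agent (i : I) : {set pairs A} :=
  [set e : pairs A | tag e == i]%SET.

Definition independent_sets t : {set {set pairs A}} :=
  [set X : {set pairs A} | (X \subset ground t) &&
    [forall i in active M t, #|X :&: ground_agent i| <= 1]%N]%SET.

Definition joint_actions t : {set {set pairs A}} :=
  [set X : {set pairs A} | (X \subset ground t) &&
    [forall i in active M t, #|X :&: ground_agent i| == 1%N]]%SET.

Definition Nmax : nat := \max_(1 <= t < T.+1) #|active M t|.

(** *** Policies and the laws they induce *)

Definition local_policies := forall i : I, O i -> A i -> R.

Definition is_local_policies (pi : local_policies) : Prop :=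
  forall t i o, in_horizon t -> i \in active M t ->
    (forall a, 0 <= pi i o a) /\ \sum_(a : A i) pi i o a = 1.

(* [prod_(i in N_t) pi^i(a_i | o_(i,t))], as [X = {(i, a_i) | i in N_t}] *)
Definition factorized (pi : local_policies) t s X : R :=
  \prod_(e in X) pi (tag e) (obs M t (tag e) s) (tagged e).

(* [q n h X] is the probability of playing [X] at time [n + 1] after the
   history [h = (s_1, a_1, ..., s_n, a_n, s_(n+1))]. *)
Definition history_policy := forall n, traj S A n -> jaction A -> R.

(* The law of the first [n] steps, by iterated composition of [init], [q] and
   [trans]; [law q] at [n = horizon M] is the law of the whole trajectory. *)
Fixpoint law (q : history_policy) n : set (traj S A n) -> \bar R :=
  match n with
  | 0 => fun B => init M [set s | B (start A s)]
  | n'.+1 => fun B =>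
      (\int[law q (n := n')]_h
         \sum_(X in joint_actions n'.+1)
           (q n' h X)%:E * trans M n'.+1 X h.2 [set s | B (extend h X s)])%E
  end.

Definition expect (q : history_policy) (f : traj S A T -> R) : R :=
  fine (\int[law q (n := T)]_tau (f tau)%:E)%E.

Definition total_utility (tau : traj S A T) : R :=
  \sum_(1 <= t < T.+1) utility M t (action_at tau t) (state_at tau t).

Definition decentralized (pi : local_policies) : history_policy :=
  fun n h X => factorized pi n.+1 h.2 X.

Definition J (pi : local_policies) : R :=
  expect (decentralized pi) total_utility.

Definition Jstar : R := sup [set J pi | pi in [set pi | is_local_policies pi]].

(** *** SubMAPL *)

Definition softmax (theta : local_policies) : local_policies :=
  fun i o a => expR (theta i o a) / \sum_(b : A i) expR (theta i o b).

(* [X :\: ground_agent i] is [A_t^(-i)]. *)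
Definition gain t s X (i : I) (a : A i) : R :=
  marginal (fun Y => utility M t Y s) (Tagged A a) (X :\: ground_agent i)%SET.

Definition logit_update (eta : R) t s X (theta : local_policies) :
    local_policies :=
  fun i o a =>
    if (i \in active M t) && (o == obs M t i s)
    then theta i o a + eta * gain t s X a else theta i o a.

Definition migrate (theta0 : local_policies) t (theta : local_policies) :
    local_policies :=
  fun i => if i \in (active M t :&: active M t.+1)%SET
           then theta i else theta0 i.

(* The logits at time [t] along the states [ss] and executed sets [Xs]. As
   [active M 0] is empty, those at time 1 are [theta0]. The logits of inactive
   agents are set to [theta0] and never used. *)
Fixpoint logits (theta0 : local_policies) (eta : R) (ss : nat -> S)
    (Xs : nat -> jaction A) t : local_policies :=
  match t with
  | 0 => theta0
  | t'.+1 => migrate theta0 t'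
      (logit_update eta t' (ss t') (Xs t') (logits theta0 eta ss Xs t'))
  end.

Section Submapl.
Variables (theta0 : local_policies) (eta : R).

(* [pi_t] and [pi_t^+] *)
Definition policy_at n (h : traj S A n) t : local_policies :=
  softmax (logits theta0 eta (state_at h) (action_at h) t).

Definition policy_post n (h : traj S A n) t : local_policies :=
  softmax (logit_update eta t (state_at h t) (action_at h t)
    (logits theta0 eta (state_at h) (action_at h) t)).

Definition submapl : history_policy :=
  fun n h X => factorized (policy_at h n.+1) n.+1 h.2 X.

Definition Jsubmapl : R := expect submapl total_utility.

End Submapl.

(** *** Stagewise comparator and KL tracking variation *)

Definition feasible_point t (x : pairs A -> R) : Prop :=
  (forall e, e \in ground t -> 0 <= x e <= 1) /\
  (forall i, i \in active M t -> \sum_(a : A i) x (Tagged A a) = 1).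

(* The expected utility of a random [X] containing exactly one element of each
   [ground_agent i], drawn independently over the active agents according
   to [x]. *)
Definition multilinear t s (x : pairs A -> R) : R :=
  \sum_(X in joint_actions t) (\prod_(e in X) x e) * utility M t X s.

Definition comparator_selection (xstar : nat -> S -> pairs A -> R) : Prop :=
  forall t, in_horizon t ->
    (forall s, feasible_point t (xstar t s) /\
       forall x, feasible_point t x ->
         multilinear t s x <= multilinear t s (xstar t s)) /\
    (forall e, e \in ground t -> measurable_fun setT (fun s => xstar t s e)).

Section Tracking.
Variable xstar : nat -> S -> pairs A -> R.

Definition comparator t s (pi : local_policies) : local_policies :=
  fun i o a => if o == obs M t i s then xstar t s (Tagged A a) else pi i o a.

(* Only applied with [q] positive; the junk values of [ln] and of division
   at 0 then only occur multiplied by [p a = 0]. *)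
Definition kl (E : finType) (p q : E -> R) : R :=
  \sum_(a : E) p a * ln (p a / q a).

Definition kl_policies t (pi pi' : local_policies) : R :=
  \sum_(i in active M t) \sum_(o : O i) kl (pi i o) (pi' i o).

Definition tracking_variation (theta0 : local_policies) (eta : R) : R :=
  expect (submapl theta0 eta) (fun tau =>
    let ps := policy_at theta0 eta tau in
    let pp := policy_post theta0 eta tau in
    let pstar t := comparator t (state_at tau t) (ps t) in
    \sum_(1 <= t < T)
      Num.max (kl_policies t.+1 (pstar t.+1) (ps t.+1)
               - kl_policies t (pstar t) (pp t)) 0).

(* [pi_1] is the softmax of the initial logits. *)
Definition initial_divergence (theta0 : local_policies) : R :=
  \int[init M]_s
    kl_policies 1 (comparator 1 s (softmax theta0)) (softmax theta0).

Definition tracking_cost (theta0 : local_policies) (eta B : R) : R :=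
  (initial_divergence theta0 + tracking_variation theta0 eta) / (2 * eta)
  + eta * T%:R * Nmax%:R * B ^+ 2 / 4.

End Tracking.

(** *** Time-expanded submodular utility *)

(* The executions prolonging [h] by [k] steps satisfy [Q], for all admissible
   joint actions and almost every state drawn from the dynamics. *)
Fixpoint feasible_after (Q : (nat -> S) -> (nat -> jaction A) -> Prop)
    k n (h : traj S A n) : Prop :=
  match k with
  | 0 => Q (state_at h) (action_at h)
  | k'.+1 => forall X, X \in joint_actions n.+1 ->
      {ae trans M n.+1 X h.2, forall s, feasible_after Q k' (extend h X s)}
  end.

(* On a general state space single states may have probability 0, so that
   "every feasible execution" is understood up to null sets of the initial
   distribution and of the transition kernels. *)
Definition forall_feasible (Q : (nat -> S) -> (nat -> jaction A) -> Prop) :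
    Prop :=
  {ae init M, forall s, feasible_after Q T (start A s)}.

(* [bar t Y] is the time-expanded set of [Y], which may depend on the
   execution; [hist t] reads the accumulated history off the state. *)
Definition time_expanded_utility : Prop :=
  exists (U : finType) (Ibar : nat -> {set {set U}}) (Fbar : {set U} -> R)
         (hist : nat -> S -> {set U}),
    [/\ forall Z, 0 <= Fbar Z,
        normalized Fbar,
        monotone_on [set: U]%SET Fbar,
        submodular_on [set: U]%SET Fbar &
        forall_feasible (fun ss Xs =>
          exists bar : nat -> {set pairs A} -> {set U},
          forall t, in_horizon t ->
            let past := (\bigcup_(1 <= k < t) bar k (Xs k))%SET in
            [/\ forall Y, Y \in independent_sets t -> bar t Y \in Ibar t,
                forall Z, Z \in Ibar t ->
                  exists2 Y, Y \in independent_sets t & bar t Y = Z,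
                hist t (ss t) = past &
                forall Y, Y \in independent_sets t ->
                  utility M t Y (ss t)
                  = Fbar (past :|: bar t Y)%SET - Fbar past])].

End OpenMDP.

(* Main.v *)
Require Import Defs.
From HB Require Import structures.
From mathcomp Require Import all_boot all_order all_algebra.
From mathcomp Require Import all_classical all_reals all_analysis.
From mathcomp Require Import measurable_realfun ring lra.

Set Implicit Arguments.
Unset Strict Implicit.
Unset Printing Implicit Defensive.
Import Order.TTheory GRing.Theory Num.Theory.
Import numFieldNormedType.Exports.

(* Two feasible executions are compared pathwise. Let [W] be the largest value
   of [Fbar] on a union of time-expanded sets, one from each [Ibar t]. Since the
   stage utilities telescope to [Fbar], every feasible execution has total
   utility at most [W], hence [Jstar <= W]; conversely, submodularity of [Fbar]
   gives [W <= sum_t F_t(A_t; s_t) + sum_t max_Y F_t(Y; s_t)] along every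
   feasible execution, and the maximum is at most the multilinear value of the
   comparator [xstar].

   At each stage, submodularity of [F_t] and independence of the agents yield,
   for the expectation over [A_t], that [f_t(xstar_t)] is at most
   [2 E F_t(A_t) + E sum_i <xstar_i - p_i, g_i>]. The last sum is the regret of
   one exponential-weights update per agent, bounded by a drop of the
   Kullback-Leibler divergence to the comparator plus [eta B^2 / 2]; these drops
   telescope up to the tracking variation.

   [hist] is arbitrary, hence possibly not measurable, so the almost sure
   statement that is transported from the dynamics to the law of the process
   is the measurable consequence
   [total <= W <= total + sum_t f_t(xstar_t)]. *)

(** The constant 1/3 collects two losses. Adjoining the best time-expanded sets to what was played
    costs one copy of the played utility. Comparing a product distribution with the played one
    through leave-one-out gains costs two more: one is the value of the executed set, the other pays
    for the gains that the agents themselves collect. Hence [W] is at most three times the SubMAPL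
    value plus twice the tracking cost.

    Two obstacles shape the rest. First, [law] is a mere set function given by iterated integrals,
    so each step is realized as a finite mixture of kernels to see that it is a probability measure.
    Integrals are taken of nonnegative functions, which avoids integrability conditions; signed
    quantities are shifted by a constant that cancels at the end. Second, [expect] is the [fine] of
    an extended integral and is faithful only when this integral is finite: the explicit bounds on
    logits and divergences are there to ensure finiteness. *)

Local Open Scope classical_set_scope.
Local Open Scope ring_scope.

(** * Mixtures of probability kernels *)

Section Mixture.
Local Open Scope ereal_scope.
Context d1 d2 d3 (X : measurableType d1) (Y : measurableType d2)
  (Z : measurableType d3) (R : realType).
Variables (N : nat) (w : nat -> X -> R) (k : nat -> R.-pker X ~> Y)
  (phi : nat -> X * Y -> Z).
Hypotheses (w_ge0 : forall i x, (i < N)%N -> (0 <= w i x)%R)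
  (w_sum1 : forall x, (\sum_(i < N) w i x = 1)%R)
  (mw : forall i, measurable_fun setT (w i))
  (mphi : forall i, measurable_fun setT (phi i)).

Let mphi2 i (x : X) : measurable_fun setT (fun y => phi i (x, y)).
Proof. exact: measurableT_comp. Qed.

(** One step of a process: an index [i] is drawn with weight [w i x], then [y] from [k i x], and the
    outcome is [phi i (x, y)], which still sees [x] so that histories can be extended. The absolute
    value provides the nonnegative type that [mscale] expects; for [i < N] it changes nothing. *)
Definition mixture_term (x : X) (i : nat) : {measure set Z -> \bar R} :=
  mscale (`|w i x|%:nng)%R
    (measure_function_pushforward__canonical__measure_function_Measure
       (k i x) (mphi2 i x)).

Definition mixture (x : X) : {measure set Z -> \bar R} := msum (mixture_term x) N.

Lemma mixtureE (x : X) (B : set Z) : mixture x B =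
  \sum_(i < N) (w i x)%:E * k i x [set y | B (phi i (x, y))].
Proof.
apply: eq_bigr => i _; rewrite -[w i x in RHS]ger0_norm ?w_ge0//.
Qed.

Lemma integral_mixture (x : X) (f : Z -> \bar R) : (forall z, 0 <= f z) ->
  measurable_fun setT f ->
  \int[mixture x]_z f z =
  \sum_(i < N) (w i x)%:E * \int[k i x]_y f (phi i (x, y)).
Proof.
move=> f0 mf; rewrite ge0_integral_measure_sum//; apply: eq_bigr => i _.
rewrite ge0_integral_mscale// -[w i x in RHS]ger0_norm ?w_ge0//.
by congr (_ * _); rewrite ge0_integral_pushforward// ?preimage_setT.
Qed.

Lemma measurable_mixture (B : set Z) : measurable B ->
  measurable_fun setT (fun x => mixture x B).
Proof.
move=> mB.
(* As the integral of an indicator depending on both [x] and [y], the kernel term falls under the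
   measurability of parametrized integrals. *)
rewrite (_ : (fun x => _) = (fun x => \sum_(i < N) (w i x)%:E *
    \int[k i x]_y (\1_B (phi i (x, y)))%:E)); last first.
  apply/funext => x; rewrite mixtureE; apply: eq_bigr => i _; congr (_ * _).
  rewrite (_ : (fun y => _) = (fun y => (\1_[set y | B (phi i (x, y))] y)%:E)).
    rewrite integral_indic//= ?setIT//.
    by rewrite -[X in measurable X]setTI; exact: mphi2.
  by apply/funext => y; rewrite !indicE; congr (_%:R%:E)%R; apply/idP/idP; rewrite !inE.
apply: emeasurable_sum => i; apply: emeasurable_funM.
  exact/measurable_EFinP.
apply: (measurable_fun_integral_finite_kernel
  (fun z => (\1_B (phi i z))%:E) (k i)) => [z|].
  by rewrite lee_fin.
apply/measurable_EFinP; apply: measurableT_comp => //.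
Qed.

HB.instance Definition _ := isKernel.Build _ _ _ _ _ mixture measurable_mixture.

Lemma mixture1 (x : X) : mixture x setT = 1.
Proof.
rewrite mixtureE (eq_bigr (fun i : 'I_N => (w i x)%:E)) => [|i _].
  by rewrite sumEFin w_sum1.
by rewrite -[RHS]mule1; congr (_ * _); exact: prob_kernel.
Qed.

HB.instance Definition _ := Kernel_isProbability.Build _ _ _ _ _ mixture mixture1.

Definition kmixture : R.-pker X ~> Z := mixture.

End Mixture.

Section Pullback.
Context d1 d2 d3 (X : measurableType d1) (X' : measurableType d2)
  (Y : measurableType d3) (R : realType).
Variables (k : R.-pker X ~> Y) (g : X' -> X) (mg : measurable_fun setT g).

(** Lets a kernel that reads only the last state act on whole histories. *)
Definition kpullback of measurable_fun setT g :=
  fun x => k (g x) : {measure set Y -> \bar R}.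

Let measurable_kpullback U : measurable U ->
  measurable_fun setT (fun x => kpullback mg x U).
Proof. by move=> mU; exact: measurableT_comp (measurable_kernel k U mU) mg. Qed.

HB.instance Definition _ :=
  isKernel.Build _ _ _ _ _ (kpullback mg) measurable_kpullback.

Let kpullback1 x : kpullback mg x setT = 1%E.
Proof. exact: prob_kernel. Qed.

HB.instance Definition _ :=
  Kernel_isProbability.Build _ _ _ _ _ (kpullback mg) kpullback1.

End Pullback.

Section UnitMass.
Context d (X : measurableType d) (R : realType) (m : {measure set X -> \bar R}).

Definition unit_mass of m setT = 1%E : set X -> \bar R := m.

Hypothesis m1 : m setT = 1%E.

HB.instance Definition _ := Measure.copy (unit_mass m1) m.
HB.instance Definition _ := Measure_isProbability.Build _ _ _ (unit_mass m1) m1.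

End UnitMass.

Lemma mixture_law d1 d2 d3 (X : measurableType d1) (Y : measurableType d2)
    (Z : measurableType d3) (R : realType) (mu : probability X R)
    (J : finType) (P : {set J}) (w : J -> X -> R) (k : J -> R.-pker X ~> Y)
    (phi : J -> X * Y -> Z) :
  (forall j x, j \in P -> 0 <= w j x) ->
  (forall x, \sum_(j in P) w j x = 1) ->
  (forall j, measurable_fun setT (w j)) ->
  (forall j, measurable_fun setT (phi j)) ->
  exists2 nu : probability Z R,
    (nu : set Z -> \bar R) = (fun B => \int[mu]_x
       \sum_(j in P) (w j x)%:E * k j x [set y | B (phi j (x, y))])%E &
    forall f : Z -> \bar R, (forall z, 0 <= f z)%E -> measurable_fun setT f ->
      (\int[nu]_z f z = \int[mu]_x
         \sum_(j in P) (w j x)%:E * \int[k j x]_y f (phi j (x, y)))%E.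
Proof.
move=> w0 w1 mw mphi.
case: (pickP (mem P)) => [j0 _|P0]; last first.
  have := w1 point; rewrite big_pred0 => [/esym/eqP|j]; last exact: P0.
  by rewrite oner_eq0.
pose e i := nth j0 (enum P) i.
pose N := #|P|.
have sumE (V : nmodType) (F : J -> V) : \sum_(j in P) F j = \sum_(i < N) F (e i).
  by rewrite -big_enum (big_nth j0) big_mkord /N cardE.
(* Kernel composition feeds the second kernel with both the source and the intermediate point. Here
   [mu] becomes a constant kernel out of [unit], so the second kernel must start from [unit * X]. *)
pose X' : measurableType _ := (unit * X)%type.
have msnd : measurable_fun setT (snd : X' -> X) by exact: measurable_snd.
pose w' i (x : X') := w (e i) x.2.
pose k' i : R.-pker X' ~> Y := kpullback (k (e i)) msnd.
pose phi' i (z : X' * Y) := phi (e i) (z.1.2, z.2).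
have w'0 i x : (i < N)%N -> 0 <= w' i x.
  by move=> iN; apply: w0; rewrite -mem_enum mem_nth// -cardE.
have w'1 x : \sum_(i < N) w' i x = 1 by rewrite -[RHS](w1 x.2) sumE.
have mw' i : measurable_fun setT (w' i) by exact: measurableT_comp.
have mphi' i : measurable_fun setT (phi' i).
  apply: measurableT_comp => //; apply/measurable_fun_pair => //.
  exact: measurableT_comp.
pose K : R.-pker X' ~> Z := kmixture k' w'0 w'1 mw' mphi'.
pose l : R.-pker unit ~> X :=
  kprobability (measurable_cst (mu : pprobability X R)).
have K1 : mkcomp l K tt setT = 1%E.
  rewrite /= /kcomp (eq_integral (cst 1%E)) => [|x _]; last exact: prob_kernel.
  by rewrite integral_cst//= probability_setT mule1.
exists (unit_mass K1 : probability Z R) => [|f f0 mf].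
  apply/funext => B; apply: eq_integral => x _.
  etransitivity; first exact: (mixtureE k' w'0 mphi' (tt, x) B).
  by rewrite [RHS]sumE.
etransitivity; first exact: (integral_kcomp l K tt f0 mf).
apply: eq_integral => x _.
etransitivity; first exact: (integral_mixture k' w'0 mphi' (tt, x) f0 mf).
by rewrite [RHS]sumE.
Qed.

(** * Measurability on trajectories *)

Lemma measurable_kernel_section d1 d2 d3 (X : measurableType d1)
    (Y : measurableType d2) (Z : measurableType d3) (R : realType)
    (k : R.-pker X ~> Y) (f : X * Y -> Z) (B : set Z) :
  measurable_fun setT f -> measurable B ->
  measurable_fun setT (fun x => k x [set y | B (f (x, y))]).
Proof.
move=> mf mB; have mfB : measurable (f @^-1` B).
  by rewrite -[X in measurable X]setTI; exact: mf.
have := measurable_fun_xsection_finite_kernel k (mem_set mfB).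
apply: eq_measurable_fun => x _; congr (k x _).
by apply/seteqP; split => y; rewrite /xsection /= inE.
Qed.

Section FiniteSums.
Context d (X : measurableType d) (R : realType) (J : Type).
Implicit Types (r : seq J) (P : pred J).

(** Only the terms selected by [P] have to be measurable: [xstar] is known to be so only at times in
    the horizon and on the ground set. *)
Lemma measurable_sum_cond r P (h : J -> X -> R) :
  (forall j, P j -> measurable_fun setT (h j)) ->
  measurable_fun setT (fun x => \sum_(j <- r | P j) h j x).
Proof.
move=> mh; rewrite (_ : (fun x => _) =
  fun x => \sum_(j <- r) (if P j then h j x else 0)); last first.
  by apply/funext => x; exact: big_mkcond.
by apply: measurable_sum => j; case: (boolP (P j)) => // Pj; exact: mh.
Qed.

Lemma emeasurable_sum_cond r P (h : J -> X -> \bar R) :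
  (forall j, P j -> measurable_fun setT (h j)) ->
  measurable_fun setT (fun x => \sum_(j <- r | P j) h j x)%E.
Proof.
move=> mh; rewrite (_ : (fun x => _) =
  fun x => \sum_(j <- r) (if P j then h j x else 0))%E; last first.
  by apply/funext => x; exact: big_mkcond.
by apply: emeasurable_sum => j; case: (boolP (P j)) => // Pj; exact: mh.
Qed.

End FiniteSums.

Section Trajectories.
Context d (S : measurableType d) (I : finType) (A : I -> finType).

Lemma measurable_start : measurable_fun setT (@start d S I A).
Proof.
apply/measurable_fun_pair => //.
Qed.

Lemma measurable_extend n (X : jaction A) : measurable_fun setT
  (fun z : traj S A n * S => extend z.1 X z.2).
Proof.
apply/measurable_fun_pair => //=.
apply/measurable_fun_tnthP => i.
have [ilt|ige] := ltnP i n.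
  rewrite (_ : _ \o _ = fun z : traj S A n * S => tnth z.1.1 (Ordinal ilt)).
    apply: (measurableT_comp (measurable_tnth (Ordinal ilt))).
    exact: measurableT_comp.
  apply/funext => z /=; rewrite !(tnth_nth (z.2, X)) /=.
  by rewrite nth_rcons size_tuple ilt.
rewrite (_ : _ \o _ = fun z : traj S A n * S => (z.1.2, X)).
  by apply/measurable_fun_pair => //; exact: measurableT_comp.
apply/funext => z /=; rewrite !(tnth_nth (z.2, X)) /=.
have -> : i = n :> nat by apply/eqP; rewrite eqn_leq ige -ltnS ltn_ord.
by rewrite nth_rcons size_tuple ltnn eqxx.
Qed.

Lemma measurable_extend_preimage n (h : traj S A n) (X : jaction A)
    (B : set (traj S A n.+1)) :
  measurable B -> measurable [set s | B (extend h X s)].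
Proof.
move=> mB; have mf := measurable_fun_pair2 h (@measurable_extend n X).
by rewrite -[X in measurable X]setTI; exact: mf.
Qed.

Lemma measurable_state_at n t :
  measurable_fun setT (fun h : traj S A n => state_at h t).
Proof.
rewrite /state_at; have [tn|nt] := ltnP t.-1 n; last first.
  rewrite (_ : (fun h => _) = snd) //.
  by apply/funext => h; rewrite nth_default// size_map size_tuple.
rewrite (_ : (fun h => _) =
  (fun h : traj S A n => (tnth h.1 (Ordinal tn)).1)).
  apply: measurableT_comp => //.
  by apply: (measurableT_comp (measurable_tnth (Ordinal tn))).
apply/funext => h; rewrite (tnth_nth (h.2, finset.set0 : jaction A)).
by rewrite (nth_map (h.2, finset.set0 : jaction A))// size_tuple.
Qed.

Lemma measurable_action_at n t (X : jaction A) :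
  measurable [set h : traj S A n | action_at h t = X].
Proof.
suff /(_ measurableT [set X]) : measurable_fun setT
    (fun h : traj S A n => action_at h t : jaction A).
  by rewrite setTI; apply.
rewrite /action_at; have [tn|nt] := ltnP t.-1 n; last first.
  rewrite (_ : (fun h => _) = cst (finset.set0 : jaction A)) //.
  by apply/funext => h; rewrite nth_default// size_map size_tuple.
rewrite (_ : (fun h => _) =
  (fun h : traj S A n => (tnth h.1 (Ordinal tn)).2)).
  apply: measurableT_comp => //.
  by apply: (measurableT_comp (measurable_tnth (Ordinal tn))).
apply/funext => h; rewrite (tnth_nth (h.2, finset.set0 : jaction A)).
by rewrite (nth_map (h.2, finset.set0 : jaction A))// size_tuple.
Qed.

Lemma state_at_last n (h : traj S A n) : state_at h n.+1 = h.2.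
Proof. by rewrite /state_at nth_default// size_map size_tuple. Qed.

Lemma state_at_extend n (h : traj S A n) X s t : (t <= n.+1)%N ->
  state_at (extend h X s) t = state_at h t.
Proof.
move=> tn; rewrite /state_at /= map_rcons nth_rcons size_map size_tuple /=.
case: ltngtP => [tlt|nlt|->].
- by apply: set_nth_default; rewrite size_map size_tuple.
- by move: tn nlt; case: t => //= t; rewrite ltnS leqNgt => /negP.
- by rewrite nth_default// size_map size_tuple.
Qed.

Lemma action_at_extend n (h : traj S A n) X s t : (0 < t <= n)%N ->
  action_at (extend h X s) t = action_at h t.
Proof.
case: t => //= t tn; rewrite /action_at /= map_rcons nth_rcons size_map.
by rewrite size_tuple tn.
Qed.

Lemma action_at_extend_last n (h : traj S A n) X s :
  action_at (extend h X s) n.+1 = X.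
Proof.
by rewrite /action_at /= map_rcons nth_rcons size_map size_tuple ltnn eqxx.
Qed.

End Trajectories.

(** * The law of the process *)

Section Law.
Context {R : realType} {d : measure_display} {S : measurableType d}.
Context {I : finType} {A O : I -> finType} (M : openMDP R S A O).

Local Notation T := (horizon M).
Local Notation history_policy := (@history_policy R d S I A).

Definition regular_policy (q : history_policy) : Prop :=
  forall n, (n < T)%N ->
  [/\ forall h X, X \in joint_actions M n.+1 -> 0 <= q n h X,
      forall h, \sum_(X in joint_actions M n.+1) q n h X = 1 &
      forall X, measurable_fun setT (fun h => q n h X)].

Variable q : history_policy.
Hypothesis q_regular : regular_policy q.

Definition last_kernel n (X : jaction A) : R.-pker (traj S A n) ~> S :=
  kpullback (trans M n.+1 X)
    (measurable_snd : measurable_fun setT (snd : traj S A n -> S)).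

(** As [law] carries no measure structure, a witness [nu] equal to it as a set function supplies
    one; rewriting with this equality turns integrals against [law] into integrals against a
    measure. *)
Lemma law_step n (mu : probability (traj S A n) R) : (n < T)%N ->
  (mu : set (traj S A n) -> \bar R) = law M q (n := n) ->
  exists2 nu : probability (traj S A n.+1) R,
    (nu : set (traj S A n.+1) -> \bar R) = law M q (n := n.+1) &
    forall f : traj S A n.+1 -> \bar R, (forall h, 0 <= f h)%E ->
      measurable_fun setT f ->
      (\int[nu]_h f h = \int[law M q (n := n)]_h
         \sum_(X in joint_actions M n.+1)
           (q h X)%:E * \int[trans M n.+1 X h.2]_s f (extend h X s))%E.
Proof.
move=> nT muE; have [q0 q1 mq] := q_regular nT.
have [] := @mixture_law _ _ _ _ S (traj S A n.+1) R mu _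
  (joint_actions M n.+1) (fun X h => q h X) (@last_kernel n)
  (fun X z => extend z.1 X z.2).
- by move=> X h; exact: q0.
- exact: q1.
- exact: mq.
- by move=> X; exact: measurable_extend.
by move=> nu nuE nu_int; exists nu; rewrite /= -muE.
Qed.

Lemma law_probability n : (n <= T)%N ->
  exists mu : probability (traj S A n) R,
    (mu : set (traj S A n) -> \bar R) = law M q (n := n).
Proof.
elim: n => [_|n IH nT].
  have p1 : measure_function_pushforward__canonical__measure_function_Measure
      (init M) (@measurable_start _ S I A) setT = 1%E.
    by rewrite /= /pushforward preimage_setT probability_setT.
  by exists (unit_mass p1 : probability _ R).
have [mu muE] := IH (ltnW nT).
by have [nu nuE _] := law_step nT muE; exists nu.
Qed.

Lemma integral_lawS n (f : traj S A n.+1 -> \bar R) : (n < T)%N ->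
  (forall h, 0 <= f h)%E -> measurable_fun setT f ->
  (\int[law M q (n := n.+1)]_h f h = \int[law M q (n := n)]_h
     \sum_(X in joint_actions M n.+1)
       (q h X)%:E * \int[trans M n.+1 X h.2]_s f (extend h X s))%E.
Proof.
move=> nT f0 mf; have [mu muE] := law_probability (ltnW nT).
by have [nu <- ->] := law_step nT muE.
Qed.

Lemma integral_law0 (f : S -> \bar R) : (forall s, 0 <= f s)%E ->
  measurable_fun setT f ->
  (\int[law M q (n := 0)]_h f h.2 = \int[init M]_s f s)%E.
Proof.
move=> f0 mf.
pose nu := measure_function_pushforward__canonical__measure_function_Measure
  (init M) (@measurable_start _ S I A).
(* At step 0, [law] is by definition the pushforward of [init M] along [start]. *)
transitivity (\int[nu]_h f h.2)%E; first by [].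
rewrite ge0_integral_pushforward ?preimage_setT//; first exact: measurable_start.
exact: measurableT_comp.
Qed.

(** The quantities accumulated at stage [n.+1] involve the state [h.2] and the action [X], not the
    state drawn afterwards, so the transition kernel integrates out with mass 1. *)
Lemma integral_lawS_cst n (V : traj S A n.+1 -> R)
    (v : traj S A n -> jaction A -> R) : (n < T)%N ->
  (forall h, 0 <= V h) -> measurable_fun setT V ->
  (forall h X s, X \in joint_actions M n.+1 -> V (extend h X s) = v h X) ->
  (\int[law M q (n := n.+1)]_h (V h)%:E = \int[law M q (n := n)]_h
     (\sum_(X in joint_actions M n.+1) q h X * v h X)%:E)%E.
Proof.
move=> nT V0 mV Vv; rewrite integral_lawS//; last exact/measurable_EFinP.
have [mu <-] := law_probability (ltnW nT).
apply: eq_integral => h _; rewrite -sumEFin; apply: eq_bigr => X XJ.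
rewrite EFinM; congr (_ * _)%E.
under eq_integral do rewrite Vv//.
by rewrite integral_cst//= prob_kernel mule1.
Qed.

(** The tower property, one stage at a time: given the history, [f] is at most the mean of [g] over
    the next action. Nonnegativity permits splitting the integrals even if they are infinite. *)
Lemma stagewise_integral_le
    (f : forall n, traj S A n -> R) (g : forall n, traj S A n -> jaction A -> R)
    (F G : forall n, traj S A n -> R) :
  (forall h, F 0 h = 0) ->
  (forall n (h : traj S A n) X s, (n < T)%N -> X \in joint_actions M n.+1 ->
     F n.+1 (extend h X s) = F n h + f n h) ->
  (forall n (h : traj S A n) X s, (n < T)%N -> X \in joint_actions M n.+1 ->
     G n.+1 (extend h X s) = G n h + g n h X) ->
  (forall n (h : traj S A n), (n < T)%N -> 0 <= f n h) ->
  (forall n h, (n <= T)%N -> 0 <= F n h) ->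
  (forall n h, (n <= T)%N -> 0 <= G n h) ->
  (forall n, (n < T)%N -> measurable_fun setT (f n)) ->
  (forall n X, (n < T)%N -> measurable_fun setT (fun h => g n h X)) ->
  (forall n, (n <= T)%N -> measurable_fun setT (F n)) ->
  (forall n, (n <= T)%N -> measurable_fun setT (G n)) ->
  (forall n (h : traj S A n), (n < T)%N ->
     f n h <= \sum_(X in joint_actions M n.+1) q h X * g n h X) ->
  (\int[law M q (n := T)]_h (F T h)%:E <= \int[law M q (n := T)]_h (G T h)%:E)%E.
Proof.
move=> F0 FS GS f0 F_ge0 G_ge0 mf mg mF mG fg.
suff : forall n, (n <= T)%N ->
    (\int[law M q (n := n)]_h (F n h)%:E <= \int[law M q (n := n)]_h (G n h)%:E)%E.
  by apply.
elim=> [_|n IH nT].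
  have [mu <-] := law_probability (leq0n _).
  rewrite integral0_eq => [|h _]; last by rewrite F0.
  by apply: integral_ge0 => h _; rewrite lee_fin; exact: G_ge0.
have [q0 q1 mq] := q_regular nT; have nT' := ltnW nT.
have [mu muE] := law_probability nT'.
rewrite (@integral_lawS_cst _ (F n.+1) (fun h _ => F n h + f n h))//;
  [|by move=> h; exact: F_ge0|exact: mF|by move=> *; exact: FS].
rewrite (@integral_lawS_cst _ (G n.+1) (fun h X => G n h + g n h X))//;
  [|by move=> h; exact: G_ge0|exact: mG|by move=> *; exact: GS].
have m_sum : measurable_fun setT
    (fun h => \sum_(X in joint_actions M n.+1) q h X * g n h X).
  by apply: measurable_sum_cond => X _; apply: measurable_funM => //; exact: mg.
have qcst (c : R) (h : traj S A n) : \sum_(X in joint_actions M n.+1) q h X * c = c.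
  by rewrite -[RHS]mul1r -(q1 h) mulr_suml.
have qsum (c : R) (v : jaction A -> R) (h : traj S A n) :
    \sum_(X in joint_actions M n.+1) q h X * (c + v X) =
    c + \sum_(X in joint_actions M n.+1) q h X * v X.
  under eq_bigr do rewrite mulrDr.
  by rewrite big_split/= qcst.
move: (IH nT'); rewrite -muE => {}IH.
under eq_integral do rewrite qcst.
under [leRHS]eq_integral do rewrite qsum.
under eq_integral do rewrite EFinD.
under [leRHS]eq_integral do rewrite EFinD.
rewrite ge0_integralD//; last 4 first.
- by move=> h _; rewrite lee_fin F_ge0.
- by apply/measurable_EFinP; exact: mF.
- by move=> h _; rewrite lee_fin f0.
- by apply/measurable_EFinP; exact: mf.
rewrite ge0_integralD//; last 4 first.
- by move=> h _; rewrite lee_fin G_ge0.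
- by apply/measurable_EFinP; exact: mG.
- by move=> h _; rewrite lee_fin; apply: le_trans (f0 _ h nT) (fg _ h nT).
- exact/measurable_EFinP.
apply: leeD => //; apply: ge0_le_integral => //.
- by move=> h _; rewrite lee_fin f0.
- by apply/measurable_EFinP; exact: mf.
- exact/measurable_EFinP.
- by move=> h _; rewrite lee_fin fg.
Qed.

Lemma integral_law_initial (g : S -> R) :
  (forall s, 0 <= g s) -> measurable_fun setT g ->
  (\int[law M q (n := T)]_h (g (state_at h 1))%:E = \int[init M]_s (g s)%:E)%E.
Proof.
move=> g0 mg.
suff : forall n, (n <= T)%N ->
    (\int[law M q (n := n)]_h (g (state_at h 1))%:E = \int[init M]_s (g s)%:E)%E.
  by apply.
elim=> [_|n IH nT].
  rewrite -(@integral_law0 (fun s => (g s)%:E))//; last exact/measurable_EFinP.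
  have [mu <-] := law_probability (leq0n _).
  by apply: eq_integral => h _; rewrite state_at_last.
have [q0 q1 mq] := q_regular nT.
rewrite (@integral_lawS_cst _ _ (fun h _ => g (state_at h 1)))//.
- rewrite -(IH (ltnW nT)); have [mu <-] := law_probability (ltnW nT).
  apply: eq_integral => h _.
  by rewrite -mulr_suml q1 mul1r.
- by apply: measurableT_comp => //; exact: measurable_state_at.
- by move=> h X s _; rewrite state_at_extend.
Qed.

Lemma measurable_feasible_after Q k n :
  (forall m, measurable [set h : traj S A m | Q (state_at h) (action_at h)]) ->
  measurable [set h : traj S A n | feasible_after M Q k h].
Proof.
move=> mQ; elim: k n => [|k IH] n; first exact: mQ.
have mC := measurableC (IH n.+1).
(* For each of the finitely many actions, the almost sure clause says that the kernel gives mass 0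
   to the failure set, which is a measurable condition on [h]. *)
rewrite [X in measurable X](_ : _ = \bigcap_(X in [set X | X \in joint_actions M n.+1])
    ((fun h : traj S A n => trans M n.+1 X h.2
       [set s | ~ feasible_after M Q k (extend h X s)]) @^-1` [set 0%E])).
  apply: fin_bigcap_measurable => [|X _]; first exact: finite_finset.
  rewrite -[X in measurable X]setTI.
  have := measurable_kernel_section
    (last_kernel n X)
    (@measurable_extend _ S I A n X) mC.
  by apply => //; exact: emeasurable_set1.
have msec (h : traj S A n) X : measurable [set s | ~ feasible_after M Q k (extend h X s)].
  exact: measurable_extend_preimage mC.
apply/seteqP; split => h /= hQ X XJ.
  by apply/negligibleP; [exact: msec|exact: (hQ X XJ)].
suff : (trans M n.+1 X h.2).-negligible
  [set s | ~ feasible_after M Q k (extend h X s)] by [].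
by apply/negligibleP; [exact: msec|exact: (hQ X XJ)].
Qed.

(** Forward induction on the steps already drawn, [T - n] steps being left to quantify over. If [h]
    is good for [k.+1] more steps, each admissible action leads to bad next states with probability
    0, so the integrand of the next [law] vanishes at [h]; the other histories are null by
    induction. *)
Lemma law_feasible Q :
  (forall m, measurable [set h : traj S A m | Q (state_at h) (action_at h)]) ->
  forall_feasible M Q ->
  law M q [set h : traj S A T | ~ Q (state_at h) (action_at h)] = 0%E.
Proof.
move=> mQ Qae.
suff /(_ T (leqnn T)) : forall n, (n <= T)%N ->
    law M q [set h : traj S A n | ~ feasible_after M Q (T - n) h] = 0%E.
  by rewrite subnn.
elim=> [_|n IH nT] /=.
  rewrite subn0; apply/negligibleP => //.
  rewrite -[X in measurable X]setTI.
  exact: (@measurable_start _ S I A measurableT _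
    (measurableC (measurable_feasible_after T (n := 0) mQ))).
have := IH (ltnW nT); have [mu muE] := law_probability (ltnW nT).
rewrite -muE -subnSK// => IHn.
set k := (T - n.+1)%N in IHn *.
transitivity (\int[mu]_h (cst 0 h))%E; last by rewrite integral0.
have mC := measurableC (measurable_feasible_after k (n := n.+1) mQ).
have mF := measurable_feasible_after k.+1 (n := n) mQ.
have [q0 q1 mq] := q_regular nT.
apply: ae_eq_integral => //.
- apply: emeasurable_sum_cond => X _; apply: emeasurable_funM.
    exact/measurable_EFinP.
  exact: (measurable_kernel_section
    (last_kernel n X)
    (@measurable_extend _ S I A n X) mC).
- exists [set h : traj S A n | ~ feasible_after M Q k.+1 h]; split => //.
    exact: measurableC.
  move=> h /=; apply: contra_not => hQ _.
  rewrite big1// => X XJ; rewrite (_ : trans M _ _ _ _ = 0)%E ?mule0//.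
  apply/negligibleP; last exact: (hQ X XJ).
  exact: measurable_extend_preimage mC.
Qed.

End Law.

(** * Submodular functions and product laws on selections *)

Section Submodular.
Context {R : realType} {U : finType}.
Variables (f : {set U} -> R) (D : {set U}).
Hypotheses (f_mono : monotone_on D f) (f_submod : submodular_on D f).
Implicit Types X Y Z : {set U}.

(** Submodularity is assumed for [e] outside [Y] only; for [e] in [Y] the left side is 0 and
    monotonicity gives the bound. *)
Lemma marginal_antimono X Y e :
  X \subset Y -> Y \subset D -> e \in D -> marginal f e Y <= marginal f e X.
Proof.
move=> XY YD eD; have [eY|eY] := boolP (e \in Y); last exact: f_submod.
rewrite /marginal (finset.setUidPr _) ?finset.sub1set// subrr subr_ge0.
apply: f_mono; rewrite ?finset.subsetUr// finset.subUset finset.sub1set eD.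
exact: fintype.subset_trans XY YD.
Qed.

(** The elements of [Z] are added one at a time, each step being [marginal_antimono]. *)
Lemma increment_antimono X Y Z : X \subset Y -> Y \subset D -> Z \subset D ->
  f (Y :|: Z)%SET - f Y <= f (X :|: Z)%SET - f X.
Proof.
move=> XY YD; have [n] := ubnP #|Z|; elim: n Z => // n IH Z Zn ZD.
have [->|[e eZ]] := finset.set_0Vmem Z; first by rewrite !finset.setU0 !subrr.
have ZeD : Z :\ e \subset D by apply: fintype.subset_trans ZD; exact: finset.subD1set.
have /IH/(_ ZeD) IHe : (#|Z :\ e| < n)%N by move: Zn; rewrite (cardsD1 e) eZ.
have mE V : (V :|: Z = e |: (V :|: Z :\ e))%SET by rewrite finset.setUCA finset.setD1K.
have eD : e \in D by exact: (fintype.subsetP ZD).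
have := @marginal_antimono (X :|: Z :\ e)%SET (Y :|: Z :\ e)%SET e.
rewrite /marginal -!mE => /(_ (finset.setSU _ XY)).
rewrite finset.subUset YD ZeD => /(_ isT eD); lra.
Qed.

Lemma increment_bigcup_le (J : Type) (r : seq J) (P : pred J) (Z : J -> {set U}) X :
  X \subset D -> (forall j, P j -> Z j \subset D) ->
  f (X :|: \bigcup_(j <- r | P j) Z j)%SET - f X <=
    \sum_(j <- r | P j) (f (X :|: Z j)%SET - f X).
Proof.
move=> XD ZD; elim: r => [|j r IH].
  by rewrite !big_nil finset.setU0 subrr.
rewrite !big_cons; case: ifP => // Pj.
have BD : (\bigcup_(j <- r | P j) Z j)%SET \subset D.
  by elim/big_rec: _ => [|k B Pk BD]; rewrite ?finset.sub0set// finset.subUset ZD.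
have := increment_antimono (finset.subsetUl X (\bigcup_(j <- r | P j) Z j)%SET) _ (ZD _ Pj).
rewrite finset.subUset XD BD => /(_ isT).
rewrite -finset.setUA (finset.setUC _ (Z j)); lra.
Qed.

Lemma increment_sum_le X Y : X \subset D -> Y \subset D ->
  f Y <= f X + \sum_(e in Y) marginal f e X.
Proof.
move=> XD YD.
have := @increment_bigcup_le _ (index_enum U) (mem Y) (fun e => [set e]%SET) X XD.
move=> /(_ (fun e eY => etrans (finset.sub1set _ _) (fintype.subsetP YD _ eY))).
have -> : (\bigcup_(e in Y) [set e] = Y)%SET.
  apply/finset.setP => e; apply/finset.bigcupP/idP => [[e' eY /finset.set1P->//]|eY].
  by exists e; rewrite ?finset.set11.
have fY : f Y <= f (X :|: Y)%SET.
  by apply: f_mono; rewrite ?finset.subsetUr// finset.subUset XD.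
rewrite lerBlDl => /(le_trans fY); congr (_ <= _ + _).
by apply: eq_bigr => e _; rewrite /marginal finset.setUC.
Qed.

(** Peeling off one element [e] splits [f X] into [f (X :\ e)] and a marginal; the leave-one-out
    marginals of the remaining elements can only grow when [e] is removed. *)
Lemma sum_marginal_le X : normalized f -> X \subset D ->
  \sum_(e in X) marginal f e (X :\ e)%SET <= f X.
Proof.
move=> f0; have [n] := ubnP #|X|; elim: n X => // n IH X Xn XD.
have [->|[e eX]] := finset.set_0Vmem X; first by rewrite finset.big_set0 f0.
have XeD : (X :\ e)%SET \subset D by apply: fintype.subset_trans XD; exact: finset.subD1set.
have /IH/(_ XeD) IHe : (#|X :\ e| < n)%N by move: Xn; rewrite (cardsD1 e) eX.
rewrite (big_setD1 e eX)/= {1}/marginal finset.setD1K//.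
suff : \sum_(i in (X :\ e)%SET) marginal f i (X :\ i)%SET <=
   \sum_(i in (X :\ e)%SET) marginal f i ((X :\ e) :\ i)%SET by lra.
apply: ler_sum => i; rewrite !inE => /andP[ie iX]; apply: marginal_antimono.
- by apply: finset.setSD; exact: finset.subD1set.
- by apply: fintype.subset_trans XD; exact: finset.subD1set.
- exact: (fintype.subsetP XD).
Qed.

End Submodular.

Section Selections.
Context {I : finType} {A : I -> finType}.
Implicit Types (D : {set I}) (X Y : {set pairs A}).

(** [joint_actions M t] unfolds to [selections (active M t)]; freeing the agent set from [t] allows
    induction on it. *)
Definition selections D : {set {set pairs A}} :=
  [set X : {set pairs A} | (X \subset [set e : pairs A | tag e \in D]) &&
    [forall i in D, #|X :&: ground_agent i| == 1%N]]%SET.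

Lemma selections_tag D X e : X \in selections D -> e \in X -> tag e \in D.
Proof.
by rewrite inE => /andP[/fintype.subsetP XD _] /XD; rewrite inE.
Qed.

Lemma selections_agent D X i : X \in selections D -> i \in D ->
  exists a : A i, (X :&: ground_agent i)%SET = [set Tagged A a]%SET.
Proof.
rewrite inE => /andP[_ /'forall_implyP X1] /X1 /cards1P[[j a] XE].
have /finset.setIP[_] : Tagged A a \in (X :&: ground_agent i)%SET by rewrite XE finset.set11.
by rewrite inE /= => /eqP ji; subst j; exists a.
Qed.

Lemma selections_inj D X e e' : X \in selections D -> e \in X -> e' \in X ->
  tag e = tag e' -> e = e'.
Proof.
move=> XD eX e'X ee'; have iD := selections_tag XD e'X.
have [a XE] := selections_agent XD iD.
have : e \in [set Tagged A a]%SET by rewrite -XE !inE eX ee' eqxx.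
have : e' \in [set Tagged A a]%SET by rewrite -XE !inE e'X eqxx.
by move=> /finset.set1P e'E /finset.set1P eE; rewrite [LHS]eE [RHS]e'E.
Qed.

Lemma selections_setD D X e : X \in selections D -> e \in X ->
  (X :\: ground_agent (tag e) = X :\ e)%SET.
Proof.
move=> XD eX; apply/finset.setP => e'; rewrite !inE.
case: (boolP (e' \in X)); rewrite ?andbF// !andbT => e'X; congr (~~ _).
by apply/eqP/eqP => [/(selections_inj XD e'X eX)//|->].
Qed.

Lemma setD_ground_agent D i (a : A i) Y : Y \in selections (D :\ i) ->
  ((Tagged A a |: Y) :\: ground_agent i)%SET = Y.
Proof.
move=> YD; apply/finset.setP => e; rewrite !inE.
case: (boolP (e \in Y)) => [eY|_].
  by have := selections_tag YD eY; rewrite !inE orbT andbT => /andP[].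
by rewrite orbF; apply/negP => /andP[/negP tn /eqP eE]; apply: tn; rewrite eE.
Qed.

Lemma selectionsD1 D i : i \in D ->
  selections D = [set Tagged A p.1 |: p.2 |
    p in finset.setX [set: A i] (selections (D :\ i))]%SET.
Proof.
move=> iD; apply/finset.setP => X.
apply/idP/finset.imsetP => [XD|[[a Y] /finset.setXP[_ /= YD] ->]].
  have [a XE] := selections_agent XD iD.
  exists (a, X :\: ground_agent i)%SET => /=; last first.
    by rewrite -XE finset.setUC; apply/finset.setP => e; rewrite !inE; case: (e \in X); case: eqP.
  apply/finset.setXP; split; rewrite ?inE//=; apply/andP; split.
    apply/fintype.subsetP => e; rewrite !inE => /andP[-> eX].
    exact: selections_tag XD eX.
  apply/'forall_implyP => j; rewrite !inE => /andP[ji jD].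
  have [b XjE] := selections_agent XD jD.
  apply/cards1P; exists (Tagged A b); rewrite -XjE.
  apply/finset.setP => e; rewrite !inE; case: (e \in X); rewrite ?andbF//= andbT.
  by case: (tag e =P j) => [->|]; rewrite ?andbF ?ji.
rewrite inE; apply/andP; split.
  rewrite finset.subUset finset.sub1set inE iD /=; apply/fintype.subsetP => e eY.
  by have := selections_tag YD eY; rewrite !inE => /andP[].
apply/'forall_implyP => j jD; apply/cards1P.
have [->|ji] := eqVneq j i.
  exists (Tagged A a); apply/finset.setP => e; rewrite !inE.
  case: (boolP (e \in Y)) => [eY|_].
    have := selections_tag YD eY; rewrite !inE orbT andTb => /andP[/negbTE-> _].
    apply/esym/negbTE; apply: contraTneq eY => ->.
    by apply/negP => /(selections_tag YD); rewrite !inE eqxx.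
  by rewrite orbF; case: eqP => //= ->; rewrite eqxx.
have [|b YE] := selections_agent YD (i := j); first by rewrite !inE ji.
exists (Tagged A b); rewrite -YE; apply/finset.setP => e; rewrite !inE.
by case: (e =P Tagged A a) => //= ->; rewrite /= eq_sym (negbTE ji) andbF.
Qed.

(** Fubini for a single agent: a selection splits uniquely, since deleting the block of [i] recovers
    [Y] and the element left over is the choice of [i]. *)
Lemma big_selectionsD1 (R : nmodType) D i (F : {set pairs A} -> R) : i \in D ->
  \sum_(X in selections D) F X =
  \sum_(Y in selections (D :\ i)) \sum_(a : A i) F (Tagged A a |: Y)%SET.
Proof.
move=> iD; rewrite (selectionsD1 iD) big_imset/=.
  rewrite exchange_big/= pair_big_dep/=.
  by apply: eq_bigl => -[a Y]; rewrite !inE.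
move=> [a Y] [b Z] /finset.setXP[_ /= YD] /finset.setXP[_ /= ZD] E.
have YZ : Y = Z by rewrite -(setD_ground_agent a YD) E (setD_ground_agent b ZD).
congr (_, _) => //; subst Z.
have : Tagged A a \in (Tagged A b |: Y)%SET by rewrite -E finset.setU11.
rewrite !inE eq_Tagged /= => /orP[/eqP-> //|/(selections_tag YD)].
by rewrite !inE eqxx.
Qed.

Lemma selections0 : selections finset.set0 = [set finset.set0]%SET.
Proof.
apply/finset.setP => X; rewrite !inE; apply/andP/eqP => [[XS _]|->].
  by apply/finset.setP => e; rewrite inE; apply/negbTE/negP => /(fintype.subsetP XS); rewrite !inE.
by split; [exact: finset.sub0set|apply/'forall_implyP => i; rewrite inE].
Qed.

End Selections.

Section ProductLaw.
Context {R : realType} {I : finType} {A : I -> finType}.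
Implicit Types (D : {set I}) (X Y : {set pairs A}) (x p : pairs A -> R).

Definition ground_of D : {set pairs A} := [set e : pairs A | tag e \in D]%SET.

Definition product_weights D x : Prop :=
  (forall e, tag e \in D -> 0 <= x e) /\
  (forall i, i \in D -> \sum_(a : A i) x (Tagged A a) = 1).

Lemma selections_sub D X : X \in selections D -> X \subset ground_of D.
Proof. by rewrite inE => /andP[]. Qed.

Lemma prod_selection_ge0 D x X : product_weights D x -> X \in selections D ->
  0 <= \prod_(e in X) x e.
Proof. by move=> [x0 _] XD; apply: prodr_ge0 => e /(selections_tag XD)/x0. Qed.

Lemma prod_setU1_selection D i (a : A i) Y x : Y \in selections (D :\ i) ->
  \prod_(e in (Tagged A a |: Y)%SET) x e =
  x (Tagged A a) * \prod_(e in Y) x e.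
Proof.
move=> YD; rewrite big_setU1//; apply/negP => /(selections_tag YD).
by rewrite !inE eqxx.
Qed.

Lemma sum_selections_prod D x :
  (forall i, i \in D -> \sum_(a : A i) x (Tagged A a) = 1) ->
  \sum_(X in selections D) \prod_(e in X) x e = 1.
Proof.
have [n] := ubnP #|D|; elim: n D => // n IH D Dn x1.
have [->|[i iD]] := finset.set_0Vmem D.
  by rewrite selections0 finset.big_set1 finset.big_set0.
rewrite (big_selectionsD1 _ iD) -[RHS](IH (D :\ i)%SET).
- apply: eq_bigr => Y YD.
  transitivity (\sum_(a : A i) x (Tagged A a) * \prod_(e in Y) x e).
    by apply: eq_bigr => a _; rewrite (prod_setU1_selection _ _ YD).
  by rewrite -mulr_suml x1// mul1r.
- by move: Dn; rewrite (cardsD1 i) iD.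
- by move=> j; rewrite !inE => /andP[_ /x1].
Qed.

Lemma sum_selections_cst D x (c : R) :
  (forall i, i \in D -> \sum_(a : A i) x (Tagged A a) = 1) ->
  \sum_(X in selections D) (\prod_(e in X) x e) * c = c.
Proof. by move=> x1; rewrite -mulr_suml sum_selections_prod// mul1r. Qed.

(* Under the product law, the [i]-th choice is independent of the others. *)
Lemma sum_selections_resample D x i (F : A i -> {set pairs A} -> R) :
  \sum_(a : A i) x (Tagged A a) = 1 -> i \in D ->
  \sum_(X in selections D) (\prod_(e in X) x e) *
    \sum_(a : A i | Tagged A a \in X) F a (X :\: ground_agent i)%SET =
  \sum_(X in selections D) (\prod_(e in X) x e) *
    \sum_(a : A i) x (Tagged A a) * F a (X :\: ground_agent i)%SET.
Proof.
move=> x1 iD; rewrite !(big_selectionsD1 _ iD); apply: eq_bigr => Y YD.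
have aY (b : A i) : Tagged A b \notin Y.
  by apply/negP => /(selections_tag YD); rewrite !inE eqxx.
transitivity (\sum_(a : A i) x (Tagged A a) * (F a Y * \prod_(e in Y) x e)).
  apply: eq_bigr => a _; rewrite (prod_setU1_selection _ _ YD) (big_pred1 a).
    by rewrite (setD_ground_agent _ YD) -mulrA [F _ _ * _]mulrC.
  by move=> b; rewrite !inE (negbTE (aY b)) orbF eq_Tagged.
transitivity (\sum_(b : A i) x (Tagged A b) *
    ((\prod_(e in Y) x e) * \sum_(a : A i) x (Tagged A a) * F a Y)); last first.
  apply: eq_bigr => b _; rewrite (prod_setU1_selection _ _ YD) mulrA.
  by congr (_ * _); apply: eq_bigr => a _; rewrite (setD_ground_agent _ YD).
rewrite -mulr_suml x1 mul1r mulr_sumr; apply: eq_bigr => a _.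
by rewrite [F _ _ * _]mulrC mulrCA.
Qed.

Lemma sum_selection D X (F : pairs A -> R) : X \in selections D ->
  \sum_(e in X) F e =
  \sum_(i in D) \sum_(a : A i | Tagged A a \in X) F (Tagged A a).
Proof.
move=> XD; rewrite (sig_big_dep _ _ (fun i a => F (Tagged A a)))/=.
apply: eq_big => [[i a]|[i a]] //=; rewrite andbC.
by case: (boolP (_ \in X)) => //= /(selections_tag XD).
Qed.

Section Stage.
Variables (D : {set I}) (f : {set pairs A} -> R).
Hypotheses (f0 : normalized f) (f_mono : monotone_on (ground_of D) f)
  (f_submod : submodular_on (ground_of D) f).

Definition gain_of X i (a : A i) : R :=
  marginal f (Tagged A a) (X :\: ground_agent i)%SET.

(** For each [Y], [f Y] is at most [f X] plus the marginals at [X] of the elements of [Y]. Removing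
    from [X] the choice of the same agent only raises such a marginal to [gain_of], and averaging
    over [Y] gives the claim. *)
Lemma sum_product_le x X : product_weights D x -> X \in selections D ->
  \sum_(Y in selections D) (\prod_(e in Y) x e) * f Y <=
  f X + \sum_(i in D) \sum_(a : A i) x (Tagged A a) * gain_of X a.
Proof.
move=> xD XD; have [x0 x1] := xD; have XS := selections_sub XD.
pose c (e : pairs A) := gain_of X (tagged e).
have le_f Y : Y \in selections D -> f Y <= f X + \sum_(e in Y) c e.
  move=> YD; apply: le_trans (increment_sum_le f_mono f_submod XS (selections_sub YD)) _.
  rewrite lerD2l; apply: ler_sum => -[i a] eY.
  apply: (marginal_antimono f_mono f_submod) => //; first exact: finset.subsetDl.
  by rewrite inE; exact: selections_tag eY.
apply: (@le_trans _ _ (\sum_(Y in selections D)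
    (\prod_(e in Y) x e) * (f X + \sum_(e in Y) c e))).
  apply: ler_sum => Y YD; apply: ler_wpM2l; last exact: le_f.
  exact: prod_selection_ge0 YD.
under eq_bigr do rewrite mulrDr.
rewrite big_split/= sum_selections_cst// lerD2l.
under eq_bigr => Y YD do rewrite (sum_selection _ YD) mulr_sumr.
rewrite exchange_big/=; apply: ler_sum => i iD.
(* The summand ignores the rest of [Y], so resampling merely replaces the event that [i] plays [a]
   by its probability. *)
have := @sum_selections_resample D x i (fun a _ => gain_of X a) (x1 i iD) iD.
by move=> ->; rewrite sum_selections_cst.
Qed.

(** Read backwards, resampling replaces the mean gain of agent [i] by the gain of the action
    actually played. The sum then consists of the leave-one-out marginals of [X], controlled by
    [sum_marginal_le]. *)
Lemma sum_gain_le p : product_weights D p ->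
  \sum_(X in selections D) (\prod_(e in X) p e) *
    (\sum_(i in D) \sum_(a : A i) p (Tagged A a) * gain_of X a) <=
  \sum_(X in selections D) (\prod_(e in X) p e) * f X.
Proof.
move=> pD; have [p0 p1] := pD.
under eq_bigr do rewrite mulr_sumr.
rewrite exchange_big/=.
under eq_bigr => i iD do rewrite /gain_of -(@sum_selections_resample D p i
  (fun a Y => marginal f (Tagged A a) Y) (p1 i iD) iD).
rewrite exchange_big/=; apply: ler_sum => X XD.
rewrite -mulr_sumr; apply: ler_wpM2l; first exact: prod_selection_ge0 XD.
apply: le_trans (sum_marginal_le f_mono f_submod f0 (selections_sub XD)).
rewrite (sum_selection _ XD).
apply: ler_sum => i iD; apply: ler_sum => a aX.
by rewrite -(selections_setD XD aX).
Qed.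

(** The factor 2 arises here: one [f X] comes from [sum_product_le], the other absorbs the
    subtracted gains of [p] through [sum_gain_le]. *)
Lemma expected_gap_ge x p c : product_weights D x -> product_weights D p ->
  \sum_(Y in selections D) (\prod_(e in Y) x e) * f Y + c <=
  \sum_(X in selections D) (\prod_(e in X) p e) * (2 * f X +
    \sum_(i in D) \sum_(a : A i)
      (x (Tagged A a) - p (Tagged A a)) * gain_of X a + c).
Proof.
move=> xD pD; have [p0 p1] := pD.
set L := \sum_(Y in _) _.
set g := fun (y : pairs A -> R) X => \sum_(i in D) \sum_(a : A i) y (Tagged A a) * gain_of X a.
have -> : \sum_(X in selections D) (\prod_(e in X) p e) * (2 * f X +
    \sum_(i in D) \sum_(a : A i)
      (x (Tagged A a) - p (Tagged A a)) * gain_of X a + c) =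
  \sum_(X in selections D) (\prod_(e in X) p e) * (f X + g x X) +
  \sum_(X in selections D) (\prod_(e in X) p e) * f X -
  \sum_(X in selections D) (\prod_(e in X) p e) * g p X + c.
  rewrite -{2}(sum_selections_cst c p1).
  rewrite -!(big_split, sumrB)/=; apply: eq_bigr => X _.
  have -> : \sum_(i in D) \sum_(a : A i)
      (x (Tagged A a) - p (Tagged A a)) * gain_of X a = g x X - g p X.
    rewrite /g -sumrB; apply: eq_bigr => i _; rewrite -sumrB.
    by apply: eq_bigr => a _; rewrite mulrBl.
  ring.
have := sum_gain_le pD; rewrite -/(g p _) => gp.
have : L <= \sum_(X in selections D) (\prod_(e in X) p e) * (f X + g x X).
  rewrite -[L](sum_selections_cst L p1).
  apply: ler_sum => X XD; apply: ler_wpM2l; first exact: prod_selection_ge0 XD.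
  exact: sum_product_le.
lra.
Qed.

(** The set [Y] may leave some agents without an action. The weights follow [Y] where it decides and
    are uniform elsewhere, so a random selection contains [Y] almost surely. *)
Lemma independent_le_product Y :
  (forall X, 0 <= f X) -> (forall i, i \in D -> (0 < #|A i|)%N) ->
  Y \subset ground_of D ->
  (forall i, i \in D -> (#|Y :&: ground_agent i| <= 1)%N) ->
  exists2 x, product_weights D x &
    f Y <= \sum_(X in selections D) (\prod_(e in X) x e) * f X.
Proof.
move=> f_ge0 A0 YD Y1.
pose x (e : pairs A) : R := if (Y :&: ground_agent (tag e) == finset.set0)%SET
  then #|A (tag e)|%:R^-1 else (e \in Y)%:R.
have xD : product_weights D x.
  split=> [e _|i iD]; rewrite /x; first by case: ifP => _; rewrite ?invr_ge0 ?ler0n.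
  have [Y0|/set0Pn[e /finset.setIP[eY]]] := eqVneq (Y :&: ground_agent i)%SET finset.set0.
    rewrite /= sumr_const -[_ *+ _]mulr_natr mulVf//.
    by rewrite pnatr_eq0 -lt0n A0.
  rewrite inE; case: e eY => j b bY /= /eqP ji; subst j.
  have YE : (Y :&: ground_agent i)%SET = [set Tagged A b]%SET.
    apply/esym/eqP; rewrite eqEcard finset.sub1set !inE bY eqxx/=.
    by rewrite cards1 Y1.
  rewrite (bigD1 b)//= bY big1 ?addr0// => a ab.
  case: (boolP (Tagged A a \in Y)) => // aY.
  have : Tagged A a \in (Y :&: ground_agent i)%SET by rewrite !inE aY eqxx.
  by rewrite YE inE eq_Tagged/= (negbTE ab).
exists x => //; rewrite -(sum_selections_cst (f Y) xD.2).
apply: ler_sum => X XD; have px0 := prod_selection_ge0 xD XD.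
(* Selections of weight 0 contribute nothing; those of nonzero weight agree with [Y] at every agent
   that [Y] serves, hence contain it. *)
have [->|px] := eqVneq (\prod_(e in X) x e) 0; first by rewrite !mul0r.
apply: ler_wpM2l => //; apply: f_mono; last exact: selections_sub.
apply/fintype.subsetP => e eY.
have eD : tag e \in D by have /fintype.subsetP/(_ _ eY) := YD; rewrite inE.
have [a Xa] := selections_agent XD eD.
have aX : Tagged A a \in X.
  have : Tagged A a \in (X :&: ground_agent (tag e))%SET.
    by rewrite Xa finset.set11.
  by case/finset.setIP.
have : x (Tagged A a) != 0.
  move: px; rewrite prodf_seq_neq0 => /allP/(_ (Tagged A a)).
  by rewrite mem_index_enum aX => /(_ isT).
rewrite /x /= ifN; last by apply/set0Pn; exists e; rewrite !inE eY eqxx.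
case: (boolP (Tagged A a \in Y)) => [aY _|]; last by rewrite eqxx.
suff -> : e = Tagged A a by [].
have /cards1P[e' YE] : #|Y :&: ground_agent (tag e)| == 1%N.
  rewrite eqn_leq Y1//= card_gt0; apply/set0Pn; exists e.
  by rewrite !inE eY eqxx.
have : e \in (Y :&: ground_agent (tag e))%SET by rewrite !inE eY eqxx.
have : Tagged A a \in (Y :&: ground_agent (tag e))%SET by rewrite !inE aY eqxx.
by rewrite YE => /finset.set1P a' /finset.set1P e''; rewrite [LHS]e'' [RHS]a'.
Qed.

End Stage.
End ProductLaw.

(** * Exponential weights and Kullback-Leibler divergence *)

Section Exponential.
Context {R : realType}.
Implicit Types z : R.

Lemma expR_ge_quadratic z : 0 <= z -> 1 + z + z ^+ 2 / 2 <= expR z.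
Proof.
move=> z0; have -> : 1 + z + z ^+ 2 / 2 = series (exp_coeff z) 3.
  rewrite /series /= !big_nat_recr//= big_geq// /exp_coeff /=.
  by rewrite expr0 expr1 fact0 !divr1 add0r.
apply: nondecreasing_cvgn_le; last exact: is_cvg_series_exp_coeff.
by apply: nondecreasing_series => n _ _; rewrite /exp_coeff/= divr_ge0// exprn_ge0.
Qed.

(** The product [(1 - z + z^2/2) (1 + z + z^2/2)] equals [1 + z^4/4], hence is at least 1, and its
    second factor is at most [expR z]. *)
Lemma expRN_le_quadratic z : 0 <= z -> expR (- z) <= 1 - z + z ^+ 2 / 2.
Proof.
move=> z0; rewrite expRN; have e0 := expR_gt0 z.
rewrite -[leLHS]div1r ler_pdivrMr//.
have p0 : 0 <= 1 - z + z ^+ 2 / 2 by nra.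
apply: le_trans (ler_wpM2l p0 (expR_ge_quadratic z0)).
have -> : (1 - z + z ^+ 2 / 2) * (1 + z + z ^+ 2 / 2) = 1 + (z ^+ 2) ^+ 2 / 4 by field.
by rewrite lerDl divr_ge0// sqr_ge0.
Qed.

Lemma ln_le_subr1 z : 0 < z -> ln z <= z - 1.
Proof.
move=> z0; rewrite -{1}[z](subrKC 1); apply: le_ln1Dx; lra.
Qed.

End Exponential.

Section KullbackLeibler.
Context {R : realType} {E : finType}.
Implicit Types (x q theta g : E -> R).

(** Gibbs' inequality, termwise: [ln u <= u - 1] at [u = q a / x a] bounds each term below by
    [x a - q a], and these differences sum to 0. *)
Lemma kl_ge0 x q : (forall a, 0 <= x a) -> (forall a, 0 < q a) ->
  \sum_a x a = 1 -> \sum_a q a = 1 -> 0 <= kl x q.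
Proof.
move=> x0 q0 x1 q1; rewrite -(subrr (1 : R)) -{1}x1 -q1 -sumrB.
apply: ler_sum => a _; have [xa|xa] := eqVneq (x a) 0.
  by rewrite xa !mul0r sub0r oppr_le0 ltW.
have {}xa : 0 < x a by rewrite lt_neqAle eq_sym xa x0.
have := ln_le_subr1 (divr_gt0 (q0 a) xa).
rewrite -[q a / x a]invf_div lnV ?posrE ?divr_gt0// => H.
have : x a * (1 - q a / x a) <= x a * ln (x a / q a).
  by rewrite ler_pM2l// -lerN2 opprB -[q a / x a]invf_div.
by rewrite mulrBr mulr1 mulrCA divff ?gt_eqF// mulr1.
Qed.

Lemma kl_le x q : (forall a, 0 <= x a <= 1) -> (forall a, 0 < q a) ->
  (forall a, q a <= 1) -> kl x q <= \sum_a - ln (q a).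
Proof.
move=> x01 q0 q1; apply: ler_sum => a _; have /andP[x0 x1] := x01 a.
have lq : 0 <= - ln (q a) by rewrite oppr_ge0 ln_le0.
have [xa|xa] := eqVneq (x a) 0; first by rewrite xa mul0r.
have {}xa : 0 < x a by rewrite lt_neqAle eq_sym xa x0.
rewrite ln_div ?posrE//.
have lx : ln (x a) <= 0 by rewrite ln_le0.
nra.
Qed.

Definition gibbs theta (a : E) : R := expR (theta a) / \sum_b expR (theta b).

Lemma sum_expR_gt0 theta (a : E) : 0 < \sum_b expR (theta b).
Proof.
by rewrite (bigD1 a)//= ltr_wpDr ?expR_gt0// sumr_ge0// => b _; exact: expR_ge0.
Qed.

Lemma gibbs_gt0 theta a : 0 < gibbs theta a.
Proof. by rewrite divr_gt0 ?expR_gt0// (sum_expR_gt0 _ a). Qed.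

Lemma sum_gibbs theta : (0 < #|E|)%N -> \sum_a gibbs theta a = 1.
Proof.
move=> /card_gt0P[a _]; rewrite -mulr_suml divff// gt_eqF//.
exact: sum_expR_gt0.
Qed.

Lemma gibbs_le1 theta a : gibbs theta a <= 1.
Proof.
rewrite ler_pdivrMr ?(sum_expR_gt0 _ a)// mul1r (bigD1 a)//= lerDl.
by apply: sumr_ge0 => b _; exact: expR_ge0.
Qed.

Lemma ln_gibbs theta a :
  ln (gibbs theta a) = theta a - ln (\sum_b expR (theta b)).
Proof. by rewrite ln_div ?expRK// posrE ?expR_gt0// (sum_expR_gt0 _ a). Qed.

Lemma ln_gibbs_ge theta a K : (forall b, `|theta b| <= K) ->
  - ln (gibbs theta a) <= K + ln (#|E|%:R * expR K).
Proof.
move=> thetaK; rewrite ln_gibbs opprB addrC lerD//.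
  by rewrite lerNl; have := thetaK a; rewrite ler_norml => /andP[].
rewrite ler_ln ?posrE ?(sum_expR_gt0 _ a)//.
  rewrite mulr_natl -sumr_const; apply: ler_sum => b _; rewrite ler_expR.
  by rewrite (le_trans (ler_norm _)).
by rewrite mulr_gt0 ?expR_gt0// ltr0n; apply/card_gt0P; exists a.
Qed.

(* With [z = eta (B - g) >= 0], bounding [expR (- z)] by its second-order
   expansion gives [eta ^ 2 B ^ 2 / 2]; Hoeffding's lemma would give the
   constant [1 / 8], which is not needed. *)
Lemma ln_sum_gibbs_le theta g (eta B : R) : 0 < eta -> (0 < #|E|)%N ->
  (forall a, 0 <= g a <= B) ->
  ln (\sum_a expR (theta a + eta * g a)) - ln (\sum_a expR (theta a)) <=
  eta * (\sum_a gibbs theta a * g a) + (eta * B) ^+ 2 / 2.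
Proof.
move=> eta0 E0 gB; have /card_gt0P[a0 _] := E0.
set Z := \sum_a expR (theta a); have Z0 : 0 < Z := sum_expR_gt0 theta a0.
set m := \sum_a _ * _; set b := eta * B.
(* Factoring out [expR b] leaves the exponential of [- (b - eta * g a)], a nonpositive number; the
   square of [b - eta * g a] is at most [b^2], so the quadratic error is the same for all [a]. *)
have step a : expR (theta a + eta * g a) <=
    Z * (expR b * (gibbs theta a * (1 - b + b ^+ 2 / 2) + eta * (gibbs theta a * g a))).
  have -> : expR (theta a + eta * g a) = Z * (gibbs theta a * (expR b * expR (- (b - eta * g a)))).
    rewrite -expRD /gibbs -/Z expRD mulrA [Z * _]mulrCA divff ?mulr1 ?gt_eqF//.
    by congr (_ * expR _); ring.
  have /andP[g0 gB'] := gB a.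
  have z0 : 0 <= b - eta * g a by rewrite -mulrBr mulr_ge0 ?subr_ge0// ltW.
  have zb : b - eta * g a <= b by rewrite gerBl mulr_ge0// ltW.
  rewrite ler_pM2l// [leLHS]mulrCA ler_pM2l ?expR_gt0//.
  rewrite [X in _ <= _ + X]mulrCA -mulrDr ler_pM2l ?gibbs_gt0//.
  apply: le_trans (expRN_le_quadratic z0) _.
  have : (b - eta * g a) ^+ 2 <= b ^+ 2 by rewrite ler_sqr ?nnegrE// (le_trans z0).
  lra.
have : \sum_a expR (theta a + eta * g a) <= Z * expR (eta * m + b ^+ 2 / 2).
  apply: le_trans (ler_sum _ (fun a _ => step a)) _.
  rewrite -mulr_sumr ler_pM2l// -mulr_sumr big_split/= -mulr_suml sum_gibbs//.
  rewrite mul1r -mulr_sumr -/m.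
  (* The factor [expR b] is matched on both sides; the rest is [1 + u <= expR u] with
     [u = - b + b^2/2 + eta * m]. *)
  have -> : eta * m + b ^+ 2 / 2 = b + (- b + b ^+ 2 / 2 + eta * m) by ring.
  rewrite [leRHS]expRD ler_pM2l ?expR_gt0//.
  by apply: le_trans (expR_ge1Dx _); rewrite !addrA.
rewrite -ler_ln ?posrE ?mulr_gt0 ?expR_gt0//; last exact: sum_expR_gt0 a0.
by rewrite lnM ?posrE ?expR_gt0// expRK -lerBlDl.
Qed.

Lemma hedge_regret_le x theta g (eta B : R) : 0 < eta -> (forall a, 0 <= x a) ->
  \sum_a x a = 1 -> (forall a, 0 <= g a <= B) ->
  \sum_a (x a - gibbs theta a) * g a <=
  (kl x (gibbs theta) - kl x (gibbs (fun a => theta a + eta * g a))) / eta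
  + eta * B ^+ 2 / 2.
Proof.
move=> eta0 x0 x1 gB.
have E0 : (0 < #|E|)%N.
  rewrite lt0n; apply/eqP => /card0_eq E0; move/eqP: x1.
  by rewrite big_pred0 ?(eq_sym 0) ?oner_eq0// => a; exact: E0.
set theta' := fun a => theta a + eta * g a.
(* The entropy of [x] cancels, and the logarithm of a [gibbs] weight is its logit minus the
   log-partition function: the drop in divergence is a linear gain minus a difference of
   log-partition functions. *)
have -> : kl x (gibbs theta) - kl x (gibbs theta') = eta * (\sum_a x a * g a)
    - (ln (\sum_a expR (theta' a)) - ln (\sum_a expR (theta a))).
  set L := ln _ - ln _; have -> : L = \sum_a x a * L by rewrite -mulr_suml x1 mul1r.
  rewrite mulr_sumr /kl -!sumrB.
  apply: eq_bigr => a _; have [->|xa] := eqVneq (x a) 0; first by rewrite !mul0r mulr0.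
  have {}xa : 0 < x a by rewrite lt_neqAle eq_sym xa x0.
  have lnxE (r : R) : 0 < r -> ln (x a / r) = ln (x a) - ln r by move=> r0; rewrite ln_div.
  rewrite !lnxE ?gibbs_gt0// !ln_gibbs /L /theta'; ring.
have := ln_sum_gibbs_le theta eta0 E0 gB; rewrite -/theta' => H.
have -> : \sum_a (x a - gibbs theta a) * g a =
    \sum_a x a * g a - \sum_a gibbs theta a * g a.
  by rewrite -sumrB; apply: eq_bigr => a _; rewrite mulrBl.
rewrite -lerBlDr ler_pdivlMr//; lra.
Qed.

End KullbackLeibler.

(** * The time-expanded value *)

Section Value.
Context {R : realType} {d : measure_display} {S : measurableType d}.
Context {I : finType} {A O : I -> finType} (M : openMDP R S A O).
Implicit Types (ss : nat -> S) (Xs : nat -> jaction A).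

Local Notation T := (horizon M).

Definition admissible Xs : Prop :=
  forall t, in_horizon M t -> Xs t \in joint_actions M t.

(** [feasible_after] prolongs histories by admissible actions only, but the property tested at the
    end does not record this. The invariant on [action_at h] carries admissibility to the end, where
    it helps to deduce [Q'] from [Q]. *)
Lemma feasible_after_admissible Q (Q' : (nat -> S) -> (nat -> jaction A) -> Prop) k n
    (h : traj S A n) : (n + k)%N = T ->
  (forall t, (0 < t <= n)%N -> action_at h t \in joint_actions M t) ->
  (forall ss Xs, admissible Xs -> Q ss Xs -> Q' ss Xs) ->
  feasible_after M Q k h -> feasible_after M Q' k h.
Proof.
move=> nkT hJ QQ'; elim: k n h nkT hJ => [|k IH] n h nkT hJ.
  rewrite addn0 in nkT; apply: QQ' => t; rewrite /in_horizon -nkT; exact: hJ.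
move=> hQ X XJ; apply: filterS (hQ X XJ) => s; apply: IH.
  by rewrite addSnnS.
move=> t /andP[t0]; rewrite leq_eqVlt => /orP[/eqP->|tn].
  by rewrite action_at_extend_last.
by rewrite action_at_extend ?hJ// t0.
Qed.

Lemma forall_feasible_admissible Q (Q' : (nat -> S) -> (nat -> jaction A) -> Prop) :
  (forall ss Xs, admissible Xs -> Q ss Xs -> Q' ss Xs) ->
  forall_feasible M Q -> forall_feasible M Q'.
Proof.
move=> QQ'; apply: filterS => s; apply: feasible_after_admissible => //.
by move=> t /andP[]; rewrite leqNgt => /negP.
Qed.

Definition total_value ss Xs : R :=
  \sum_(1 <= t < T.+1) utility M t (Xs t) (ss t).

Variable xstar : nat -> S -> pairs A -> R.
Hypotheses
  (utility_submodular : forall t s, in_horizon M t ->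
      [/\ normalized (fun X => utility M t X s),
          monotone_on (ground M t) (fun X => utility M t X s) &
          submodular_on (ground M t) (fun X => utility M t X s)])
  (action_nonempty : forall t i, in_horizon M t -> i \in active M t ->
      (0 < #|A i|)%N)
  (xstar_selection : comparator_selection M xstar).

Definition comparator_value t s : R := multilinear M t s (xstar t s).

Lemma feasible_product_weights t x :
  feasible_point M t x -> product_weights (active M t) x.
Proof.
by move=> [x01 x1]; split => // e eD; have /andP[] : 0 <= x e <= 1 by apply: x01; rewrite inE.
Qed.

Lemma product_weights_feasible t x :
  product_weights (active M t) x -> feasible_point M t x.
Proof.
move=> [x0 x1]; split=> // -[i a]; rewrite inE /= => iD.
rewrite x0//= -(x1 i iD) (bigD1 a)//= lerDl.
by apply: sumr_ge0 => b _; exact: x0.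
Qed.

Lemma comparator_value_ge0 t s : in_horizon M t -> 0 <= comparator_value t s.
Proof.
move=> tT; have [/(_ s)[xF _] _] := xstar_selection tT.
apply: sumr_ge0 => X XJ; rewrite mulr_ge0 ?utility_ge0//.
exact: prod_selection_ge0 (feasible_product_weights xF) XJ.
Qed.

(** Independent sets are needed, not just joint actions, because an element of [Ibar t] may come
    from a set in which some agents play nothing. *)
Lemma utility_le_comparator t s Y : in_horizon M t ->
  Y \in independent_sets M t -> utility M t Y s <= comparator_value t s.
Proof.
move=> tT; rewrite inE => /andP[YD /'forall_implyP Y1].
have [u0 um us] := utility_submodular s tT.
have [x xw] := independent_le_product um (fun X => utility_ge0 M t X s)
  (fun i iD => action_nonempty tT iD) YD Y1.
move=> /le_trans; apply; have [/(_ s)[_ +] _] := xstar_selection tT; apply.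
exact: product_weights_feasible.
Qed.

Lemma joint_actions_independent t X :
  X \in joint_actions M t -> X \in independent_sets M t.
Proof.
rewrite !inE => /andP[-> /'forall_implyP X1] /=.
by apply/'forall_implyP => i /X1 /eqP ->.
Qed.

Section TimeExpanded.
Context {U : finType} (Fbar : {set U} -> R) (Ibar : nat -> {set {set U}}).
Hypotheses (F_ge0 : forall Z, 0 <= Fbar Z) (F0 : normalized Fbar)
  (F_mono : monotone_on [set: U]%SET Fbar)
  (F_submod : submodular_on [set: U]%SET Fbar).

(** Only [Fbar] and [Ibar] enter, and neither depends on the execution, unlike [bar]: thus one value
    serves all policies. Index 0 of [Z] is unconstrained and stays outside the union. *)
Definition expanded_value : R :=
  \big[Num.max/0]_(Z : {ffun 'I_T.+1 -> {set U}} |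
      [forall t : 'I_T.+1, (0 < t)%N ==> (Z t \in Ibar t)])
    Fbar (\bigcup_(1 <= k < T.+1) Z (inord k))%SET.

Variables (ss : nat -> S) (Xs : nat -> jaction A).
Variable bar : nat -> {set pairs A} -> {set U}.

Local Notation past t := (\bigcup_(1 <= k < t) bar k (Xs k))%SET.

Hypotheses (Xs_admissible : admissible Xs)
  (bar_in : forall t Y, in_horizon M t -> Y \in independent_sets M t ->
     bar t Y \in Ibar t)
  (bar_onto : forall t Z, in_horizon M t -> Z \in Ibar t ->
     exists2 Y, Y \in independent_sets M t & bar t Y = Z)
  (barE : forall t Y, in_horizon M t -> Y \in independent_sets M t ->
     utility M t Y (ss t) = Fbar (past t :|: bar t Y)%SET - Fbar (past t)).

Lemma total_valueE : total_value ss Xs = Fbar (past T.+1).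
Proof.
have := telescope_sumr (fun t => Fbar (past t)) (ltn0Sn T).
rewrite [X in _ - X](_ : _ = 0) ?subr0; last by rewrite big_geq.
move=> <-.
apply: eq_big_nat => t tT; rewrite barE//; last first.
  by apply: joint_actions_independent; exact: Xs_admissible.
by rewrite big_nat_recr//=; case/andP: tT.
Qed.

Lemma total_value_le_expanded : total_value ss Xs <= expanded_value.
Proof.
rewrite total_valueE.
pose Z : {ffun 'I_T.+1 -> {set U}} := [ffun t : 'I_T.+1 => bar t (Xs t)].
have -> : past T.+1 = (\bigcup_(1 <= k < T.+1) Z (inord k))%SET.
  by apply: eq_big_nat => k /andP[_ kT]; rewrite ffunE inordK.
apply: (le_bigmax_cond _ (fun Z : {ffun _ -> _} => Fbar _)).
apply/forallP => t; apply/implyP => t0; rewrite ffunE.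
have tT : in_horizon M t by rewrite /in_horizon t0 -ltnS ltn_ord.
by apply: bar_in => //; apply: joint_actions_independent; exact: Xs_admissible.
Qed.

Lemma expanded_le_total_value : expanded_value <=
  total_value ss Xs + \sum_(1 <= t < T.+1) comparator_value t (ss t).
Proof.
apply: bigmax_le => [|Z /'forall_implyP ZI].
  rewrite addr_ge0// /total_value big_nat sumr_ge0// => t tT.
    exact: utility_ge0.
  exact: comparator_value_ge0.
rewrite total_valueE -lerBlDl; set P := past T.+1.
have subT (V : {set U}) : V \subset [set: U]%SET by exact: finset.subsetT.
apply: (@le_trans _ _ (Fbar (P :|: \bigcup_(1 <= k < T.+1) Z (inord k))%SET - Fbar P)).
  by rewrite lerD2r; apply: F_mono => //; exact: finset.subsetUr.
apply: le_trans (increment_bigcup_le F_mono F_submod _ (subT P) (fun _ _ => subT _)) _.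
apply: ler_sum_nat => t tT.
have [||Y YI YZ] := @bar_onto t (Z (inord t)); first exact: tT.
  have := ZI (inord t); rewrite inordK; [apply|]; by case/andP: tT.
rewrite -YZ; apply: le_trans (utility_le_comparator (ss t) tT YI).
(* The stage utility is an increment over the past before [t], while [Z] was adjoined to the whole
   history [P], which contains that past; by submodularity the stage increment is the larger one. *)
rewrite barE//; apply: increment_antimono F_mono F_submod _ _ _ _ _ _ => //.
case/andP: tT => t0 tT.
rewrite /P (_ : past T.+1 = past t :|: \bigcup_(t <= k < T.+1) bar k (Xs k))%SET.
  exact: finset.subsetUl.
by rewrite -big_cat_nat// ltnW.
Qed.

End TimeExpanded.

Lemma time_expanded_value : time_expanded_utility M -> exists2 W, 0 <= W & forall_feasible M
  (fun ss Xs => [/\ admissible Xs, total_value ss Xs <= W &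
     W <= total_value ss Xs + \sum_(1 <= t < T.+1) comparator_value t (ss t)]).
Proof.
move=> [U [Ibar [Fbar [hist [F_ge0 F0 F_mono F_submod]]]]] feas.
exists (expanded_value Fbar Ibar); first exact: bigmax_ge_id.
apply: forall_feasible_admissible feas => ss Xs adm [bar barP]; split => //.
- apply: (total_value_le_expanded F0 (bar := bar)) => // t Y tT YI;
    have [H1 H2 _ H3] := barP t tT; [exact: H1|exact: H3].
- apply: (expanded_le_total_value F0 F_mono F_submod (bar := bar)) => // t Y tT YI;
    have [H1 H2 _ H3] := barP t tT; [exact: H2|exact: H3].
Qed.

End Value.

(** * Pathwise analysis of SubMAPL *)

(** The left sum is [a 1] plus the differences [a t.+1 - b t], minus [b n.+1]. The last term is
    dropped by its sign, the differences are replaced by their positive parts. In use, [n.+1] is the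
    horizon. *)
Lemma telescope_positive_part_le (R : realType) (a b : nat -> R) n : 0 <= b n.+1 ->
  \sum_(1 <= t < n.+2) (a t - b t) <=
  a 1%N + \sum_(1 <= t < n.+1) Num.max (a t.+1 - b t) 0.
Proof.
move=> bn; suff : \sum_(1 <= t < n.+2) (a t - b t) <=
    a 1%N + \sum_(1 <= t < n.+1) Num.max (a t.+1 - b t) 0 - b n.+1 by lra.
elim: n {bn} => [|n IH]; first by rewrite big_nat1 big_geq// addr0.
rewrite big_nat_recr//= [X in _ + X - _]big_nat_recr//=.
have : a n.+2 - b n.+1 <= Num.max (a n.+2 - b n.+1) 0 by rewrite le_max lexx.
lra.
Qed.

Section Algorithm.
Context {R : realType} {d : measure_display} {S : measurableType d}.
Context {I : finType} {A O : I -> finType} (M : openMDP R S A O).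
Variables (theta0 : forall i : I, O i -> A i -> R) (eta B : R)
    (xstar : nat -> S -> pairs A -> R).
Hypotheses (eta_gt0 : 0 < eta)
    (utility_submodular : forall t s, in_horizon M t ->
      [/\ normalized (fun X => utility M t X s),
          monotone_on (ground M t) (fun X => utility M t X s) &
          submodular_on (ground M t) (fun X => utility M t X s)])
    (action_nonempty : forall t i, in_horizon M t -> i \in active M t ->
      (0 < #|A i|)%N)
    (marginal_bounded : forall t s (X : {set pairs A}) (e : pairs A),
      in_horizon M t -> X \subset ground M t -> e \in ground M t :\: X ->
      0 <= marginal (fun Y => utility M t Y s) e X <= B)
    (xstar_selection : comparator_selection M xstar).

Local Notation T := (horizon M).
Local Notation policies := (forall i : I, O i -> A i -> R).
Implicit Types (ss : nat -> S) (Xs : nat -> jaction A) (theta : policies).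

Local Notation logits_at ss Xs t := (logits M theta0 eta ss Xs t).

Lemma migrate0 theta : migrate M theta0 0 theta = theta0.
Proof. by apply: functional_extensionality_dep => i; rewrite /migrate active0 finset.set0I inE. Qed.

(** The update at time [k] enters at [k.+1], so the logits at [t] do not see the state and action of
    [t] itself. Agreement at time 0 is not asked for, since [migrate] at 0 resets all logits. *)
Lemma eq_logits ss Xs ss' Xs' t :
  (forall k, (0 < k < t)%N -> ss k = ss' k) ->
  (forall k, (0 < k < t)%N -> Xs k = Xs' k) ->
  logits_at ss Xs t = logits_at ss' Xs' t.
Proof.
elim: t => [//|[|t] IH] Hs HX; first by rewrite /= !migrate0.
have E : logits_at ss Xs t.+1 = logits_at ss' Xs' t.+1.
  by apply: IH => k /andP[k0 kt]; [apply: Hs|apply: HX]; rewrite k0 ltnW.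
transitivity (migrate M theta0 t.+1
  (logit_update M eta t.+1 (ss t.+1) (Xs t.+1) (logits_at ss Xs t.+1))) => //.
by rewrite E Hs ?HX ?ltnSn.
Qed.

Lemma softmaxE theta i o a : softmax theta o a = gibbs (theta i o) a.
Proof. by []. Qed.

Lemma gain_bounded t s X i a : in_horizon M t -> X \in joint_actions M t ->
  i \in active M t -> 0 <= gain M t s X (a : A i) <= B.
Proof.
move=> tT XJ iD; apply: marginal_bounded => //.
  by apply: fintype.subset_trans (selections_sub XJ); exact: finset.subsetDl.
by rewrite !inE eqxx iD.
Qed.

Lemma card_active_le t : in_horizon M t -> (#|active M t| <= Nmax M)%N.
Proof.
move=> tT; rewrite /Nmax (bigD1_seq t) ?iota_uniq//= ?leq_maxl//.
by rewrite mem_index_iota ltnS.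
Qed.

(** One [hedge_regret_le] per active agent, each paying [eta * B^2 / 2]; bounding their number by
    [Nmax M] frees the constant from [t]. *)
Lemma kl_drift_ge t s X theta : in_horizon M t -> X \in joint_actions M t ->
  \sum_(i in active M t) \sum_(a : A i)
    (xstar t s (Tagged A a) - softmax theta (obs M t i s) a) * gain M t s X a <=
  (kl_policies M t (comparator M xstar t s (softmax theta)) (softmax theta) -
   kl_policies M t (comparator M xstar t s (softmax theta))
     (softmax (logit_update M eta t s X theta))) / eta +
  eta * (Nmax M)%:R * B ^+ 2 / 2.
Proof.
move=> tT XJ; have [/(_ s)[xF _] _] := xstar_selection tT.
have [x0 x1] := feasible_product_weights xF.
set pi := softmax theta; set pi' := softmax _; set pis := comparator _ _ _ _ _.
have row i : i \in active M t ->
    \sum_(a : A i) (xstar t s (Tagged A a) - pi i (obs M t i s) a) * gain M t s X a <=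
    (\sum_(o : O i) kl (pis i o) (pi i o) - \sum_(o : O i) kl (pis i o) (pi' i o)) / eta
    + eta * B ^+ 2 / 2.
  (* Only the row of the observed value of [o_(i,t)] is updated. *)
  move=> iD; have -> : \sum_(o : O i) kl (pis i o) (pi i o) -
        \sum_(o : O i) kl (pis i o) (pi' i o) =
      kl (pis i (obs M t i s)) (pi i (obs M t i s)) -
        kl (pis i (obs M t i s)) (pi' i (obs M t i s)).
    rewrite -sumrB (bigD1 (obs M t i s))//= [X in _ + X]big1 ?addr0// => o oo.
    rewrite (_ : pi' i o = pi i o) ?subrr//; apply/funext => a.
    by rewrite /pi' /softmax /logit_update (negbTE oo) andbF.
  have pisE : pis i (obs M t i s) = fun a => xstar t s (Tagged A a).
    by apply/funext => a; rewrite /pis /comparator eqxx.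
  have pi'E : pi' i (obs M t i s) =
      gibbs (fun a => theta i (obs M t i s) a + eta * gain M t s X a).
    by apply/funext => a; rewrite /pi' /softmax /logit_update iD eqxx.
  rewrite pisE pi'E; apply: hedge_regret_le => //.
  - by move=> a; apply: x0.
  - exact: x1.
  - by move=> a; exact: gain_bounded.
apply: le_trans (ler_sum _ row) _.
rewrite big_split/= -mulr_suml sumrB /kl_policies lerD2l sumr_const -mulr_natr.
have : #|active M t|%:R <= (Nmax M)%:R :> R by rewrite ler_nat card_active_le.
have : 0 <= eta * B ^+ 2 / 2 by rewrite divr_ge0// mulr_ge0 ?sqr_ge0// ltW.
nra.
Qed.

(* Makes [stage_gap] nonnegative, so that all integrals are of nonnegative
   functions. *)
Definition gap_shift : R := (Nmax M)%:R * `|B|.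

Definition stage_gap t s X theta : R := 2 * utility M t X s +
  \sum_(i in active M t) \sum_(a : A i)
    (xstar t s (Tagged A a) - softmax theta (obs M t i s) a) * gain M t s X a +
  gap_shift.

Lemma stage_gap_ge0 t s X theta : in_horizon M t -> X \in joint_actions M t ->
  0 <= stage_gap t s X theta.
Proof.
move=> tT XJ; have [/(_ s)[xF _] _] := xstar_selection tT.
have [x0 x1] := feasible_product_weights xF.
suff : - gap_shift <= \sum_(i in active M t) \sum_(a : A i)
    (xstar t s (Tagged A a) - softmax theta (obs M t i s) a) * gain M t s X a.
  by have := utility_ge0 M t X s; rewrite /stage_gap; lra.
apply: (@le_trans _ _ (\sum_(i in active M t) - `|B|)).
  rewrite sumr_const mulNrn -mulr_natl lerN2; apply: ler_wpM2r => //.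
  by rewrite ler_nat card_active_le.
apply: ler_sum => i iD.
(* Spread over the probabilities [p] of the row, the bound reduces to one action, where [x g >= 0]
   and [p g <= p |B|]. *)
rewrite -[leLHS]mulr1 -(sum_gibbs (theta i (obs M t i s)) (action_nonempty tT iD)).
rewrite mulr_sumr; apply: ler_sum => a _; rewrite softmaxE.
have /andP[g0 gB] := gain_bounded s a tT XJ iD.
have q0 := gibbs_gt0 (theta i (obs M t i s)) a.
have xa : 0 <= xstar t s (Tagged A a) by apply: x0.
have := ler_norm B; nra.
Qed.

Definition kl_start s : R :=
  kl_policies M 1 (comparator M xstar 1 s (softmax theta0)) (softmax theta0).

Definition kl_variation ss Xs : R :=
  let ps t := softmax (logits_at ss Xs t) in
  let pp t := softmax (logit_update M eta t (ss t) (Xs t) (logits_at ss Xs t)) in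
  let pstar t := comparator M xstar t (ss t) (ps t) in
  \sum_(1 <= t < T)
    Num.max (kl_policies M t.+1 (pstar t.+1) (ps t.+1)
             - kl_policies M t (pstar t) (pp t)) 0.

Lemma comparator_row_ge0 t s pi i o a : in_horizon M t -> i \in active M t ->
  (forall a, 0 <= pi i o a) -> 0 <= comparator M xstar t s pi o (a : A i).
Proof.
move=> tT iD pi0; have [/(_ s)[xF _] _] := xstar_selection tT.
have [x0 x1] := feasible_product_weights xF.
by rewrite /comparator; case: ifP => // _; apply: x0.
Qed.

Lemma comparator_row_sum t s pi i o : in_horizon M t -> i \in active M t ->
  \sum_a pi i o a = 1 -> \sum_(a : A i) comparator M xstar t s pi o a = 1.
Proof.
move=> tT iD pi1; have [/(_ s)[xF _] _] := xstar_selection tT.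
have [x0 x1] := feasible_product_weights xF.
by rewrite /comparator; case: (boolP (o == obs M t i s)) => _ //; exact: x1.
Qed.

Lemma kl_comparator_ge0 t s theta theta' : in_horizon M t ->
  0 <= kl_policies M t (comparator M xstar t s (softmax theta)) (softmax theta').
Proof.
move=> tT; apply: sumr_ge0 => i iD; apply: sumr_ge0 => o _.
have A0 := action_nonempty tT iD; apply: kl_ge0 => [a|a||].
- by apply: comparator_row_ge0 => // b; exact/ltW/gibbs_gt0.
- exact: gibbs_gt0.
- by apply: comparator_row_sum => //; exact: sum_gibbs.
- exact: sum_gibbs.
Qed.

Lemma sum_stage_gap_le ss Xs : admissible M Xs ->
  \sum_(1 <= t < T.+1) stage_gap t (ss t) (Xs t) (logits_at ss Xs t) <=
  2 * total_value M ss Xs + (kl_start (ss 1%N) + kl_variation ss Xs) / eta +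
  (eta * T%:R * (Nmax M)%:R * B ^+ 2 / 2 + T%:R * gap_shift).
Proof.
move=> adm; set th := fun t => logits_at ss Xs t.
set a := fun t => kl_policies M t (comparator M xstar t (ss t) (softmax (th t))) (softmax (th t)).
set b := fun t => kl_policies M t (comparator M xstar t (ss t) (softmax (th t)))
     (softmax (logit_update M eta t (ss t) (Xs t) (th t))).
set C := eta * (Nmax M)%:R * B ^+ 2 / 2.
have sum_cst (c : R) : \sum_(1 <= t < T.+1) c = T%:R * c.
  by rewrite sumr_const_nat subSS subn0 mulr_natl.
apply: (@le_trans _ _ (\sum_(1 <= t < T.+1)
    (2 * utility M t (Xs t) (ss t) + ((a t - b t) / eta + C) + gap_shift))).
  apply: ler_sum_nat => t tT; rewrite lerD2r lerD2l.
  by apply: kl_drift_ge => //; exact: adm.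
rewrite !big_split/= !sum_cst -mulr_sumr -mulr_suml -/(total_value M ss Xs).
have : \sum_(1 <= t < T.+1) (a t - b t) <= kl_start (ss 1%N) + kl_variation ss Xs.
  have -> : kl_start (ss 1%N) = a 1%N by rewrite /a /th /= migrate0.
  have := @telescope_positive_part_le R a b T.-1; rewrite prednK ?horizon_gt0//; apply.
  by apply: kl_comparator_ge0; rewrite /in_horizon horizon_gt0 leqnn.
rewrite -(ler_pM2r (x := eta^-1)) ?invr_gt0// => H.
have -> : eta * T%:R * (Nmax M)%:R * B ^+ 2 / 2 = T%:R * C by rewrite /C; ring.
lra.
Qed.

(** Each agent draws independently from its row at the current observation, so [factorized] is a
    product law to which [expected_gap_ge] applies. *)
Lemma expected_stage_gap_ge t s theta : in_horizon M t ->
  comparator_value M xstar t s + gap_shift <=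
  \sum_(X in joint_actions M t)
    factorized M (softmax theta) t s X * stage_gap t s X theta.
Proof.
move=> tT; have [/(_ s)[xF _] _] := xstar_selection tT.
have [u0 um us] := utility_submodular s tT.
apply: (expected_gap_ge u0 um us gap_shift (feasible_product_weights xF)
  (p := fun e => softmax theta (obs M t (tag e) s) (tagged e))).
split=> [e _|i iD]; first exact/ltW/gibbs_gt0.
exact: sum_gibbs (action_nonempty tT iD).
Qed.

Definition logit_bound : R :=
  \sum_(i : I) \sum_(o : O i) \sum_(a : A i) `|theta0 o a| + eta * `|B| * T%:R.

(** An update moves a logit by at most [eta * |B|], and arriving agents restart from [theta0].
    Bounded logits keep softmax probabilities away from 0, hence the divergences bounded. *)
Lemma logits_le ss Xs t i o (a : A i) : admissible M Xs -> (t <= T)%N ->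
  `|logits_at ss Xs t o a| <= logit_bound.
Proof.
move=> adm tT; set K0 := \sum_(i : I) \sum_(o : O i) \sum_(a : A i) `|theta0 o a|.
have e0 : 0 <= eta * `|B| by rewrite mulr_ge0// ltW.
apply: (@le_trans _ _ (K0 + eta * `|B| * t%:R)); last first.
  by rewrite lerD2l; apply: ler_wpM2l; rewrite ?ler_nat.
have theta0K j (p : O j) (b : A j) : `|theta0 p b| <= K0.
  rewrite /K0 (bigD1 j)//= (bigD1 p)//= (bigD1 b)//= -!addrA lerDl.
  by rewrite !addr_ge0//; do ?[apply: sumr_ge0 => *].
elim: t tT i o a => [_|t IH tT] i o a; first by rewrite mulr0 addr0.
have K0' : K0 <= K0 + eta * `|B| * t.+1%:R by rewrite lerDl mulr_ge0.
(* Time 0 lies outside the horizon, where gains are not controlled; [migrate0] erases its update. *)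
rewrite [logits_at _ _ _]/=; case: t => [|t] in IH tT K0' *.
  by rewrite migrate0 (le_trans (theta0K _ _ _)).
rewrite /migrate; case: ifP => _; last by rewrite (le_trans (theta0K _ _ _)).
have IHt := IH (ltnW tT) i o a.
rewrite /logit_update; case: ifP => [/andP[iD _]|_]; last first.
  apply: le_trans IHt _; rewrite lerD2l; apply: ler_wpM2l => //.
  by rewrite ler_nat.
apply: le_trans (ler_normD _ _) _.
have -> : eta * `|B| * t.+2%:R = eta * `|B| * t.+1%:R + eta * `|B|.
  by rewrite -[in LHS]natr1 mulrDr mulr1.
rewrite addrA; apply: lerD => //.
have tT' : in_horizon M t.+1 by apply/andP; split=> //; exact: ltnW.
have /andP[g0 gB] := gain_bounded (ss t.+1) a tT' (adm _ tT') iD.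
rewrite normrM (gtr0_norm eta_gt0); apply: ler_wpM2l; first exact: ltW.
by rewrite (ger0_norm g0) (le_trans gB)// ler_norm.
Qed.

Definition kl_bound K : R := \sum_(i : I) \sum_(o : O i) \sum_(a : A i)
  `|K + ln (#|A i|%:R * expR K)|.

Lemma kl_comparator_le t s theta K : in_horizon M t ->
  (forall i o a, `|theta i o a| <= K) ->
  kl_policies M t (comparator M xstar t s (softmax theta)) (softmax theta) <=
  kl_bound K.
Proof.
move=> tT thK; rewrite /kl_policies big_mkcond/=; apply: ler_sum => i _.
case: ifP => iD; last first.
  by apply: sumr_ge0 => o _; apply: sumr_ge0.
apply: ler_sum => o _; apply: le_trans (kl_le _ _ _) _.
- move=> a; have c0 b : 0 <= comparator M xstar t s (softmax theta) o (b : A i).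
    by apply: comparator_row_ge0 => // c; exact/ltW/gibbs_gt0.
  rewrite c0//= -(@comparator_row_sum t s (softmax theta) i o)//.
    by rewrite (bigD1 a)//= lerDl sumr_ge0.
  exact: sum_gibbs (action_nonempty tT iD).
- by move=> a; exact: gibbs_gt0.
- by move=> a; exact: gibbs_le1.
- apply: ler_sum => a _; apply: le_trans (ler_norm _).
  exact: ln_gibbs_ge (thK i o).
Qed.

Lemma kl_start_ge0 s : 0 <= kl_start s.
Proof. by apply: kl_comparator_ge0; rewrite /in_horizon horizon_gt0. Qed.

Lemma kl_start_le s : kl_start s <= kl_bound logit_bound.
Proof.
apply: kl_comparator_le => [|i o a]; first by rewrite /in_horizon horizon_gt0.
rewrite /logit_bound (bigD1 i)//= (bigD1 o)//= (bigD1 a)//= -!addrA lerDl.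
by rewrite !addr_ge0//; do ?[apply: sumr_ge0 => *]; rewrite ?mulr_ge0// ltW.
Qed.

Lemma kl_variation_ge0 ss Xs : 0 <= kl_variation ss Xs.
Proof. by apply: sumr_ge0 => t _; rewrite le_max lexx orbT. Qed.

Lemma kl_variation_le ss Xs : admissible M Xs ->
  kl_variation ss Xs <= T%:R * kl_bound logit_bound.
Proof.
move=> adm; apply: (@le_trans _ _ (\sum_(1 <= t < T) kl_bound logit_bound)).
  apply: ler_sum_nat => t /andP[t0 tT].
  have b0 := le_trans (kl_start_ge0 (ss 1%N)) (kl_start_le (ss 1%N)).
  rewrite ge_max b0 andbT lerBlDr -[leLHS]addr0; apply: lerD.
    by apply: kl_comparator_le => // i o a; exact: logits_le.
  by apply: kl_comparator_ge0; rewrite /in_horizon t0 ltnW.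
rewrite sumr_const_nat -[leLHS]mulr_natl; apply: ler_wpM2r.
  exact: le_trans (kl_start_ge0 (ss 1%N)) (kl_start_le (ss 1%N)).
by rewrite ler_nat leq_subr.
Qed.

End Algorithm.

(** * Measurability of the algorithm *)

(** The map [g] cuts the space into finitely many measurable pieces, on each of which a single [F e]
    is evaluated. It will be an observation or an executed set. *)
Lemma measurable_fun_fin_index d1 d2 (Z : measurableType d1)
    (Y : measurableType d2) (E : finType) (g : Z -> E) (F : E -> Z -> Y) :
  (forall e, measurable [set z | g z = e]) ->
  (forall e, measurable_fun setT (F e)) ->
  measurable_fun setT (fun z => F (g z) z).
Proof.
move=> mg mF _ B mB; rewrite setTI.
rewrite (_ : _ @^-1` _ = \bigcup_(e in [set: E]) ([set z | g z = e] `&` F e @^-1` B)).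
  apply: fin_bigcup_measurable; first exact: finite_finset.
  move=> e _; apply: measurableI => //; rewrite -[X in measurable X]setTI.
  exact: mF.
by apply/seteqP; split => [z Bz|z [e _ [<-]]]//; exists (g z).
Qed.

Lemma measurable_prod_cond d (X : measurableType d) (R : realType) (J : Type)
    (r : seq J) (P : pred J) (h : J -> X -> R) :
  (forall j, P j -> measurable_fun setT (h j)) ->
  measurable_fun setT (fun x => \prod_(j <- r | P j) h j x).
Proof.
move=> mh; elim: r => [|j r IH].
  by under eq_fun do rewrite big_nil; exact: measurable_cst.
under eq_fun do rewrite big_cons.
by case: (boolP (P j)) => // Pj; apply: measurable_funM => //; exact: mh.
Qed.

Section MeasurableGibbs.
Context d (Z : measurableType d) (R : realType) (E : finType).
Variable theta : Z -> E -> R.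
Hypothesis m_theta : forall a, measurable_fun setT (fun z => theta z a).

Lemma measurable_ln_gibbs a : measurable_fun setT (fun z => ln (gibbs (theta z) a)).
Proof.
under eq_fun do rewrite ln_gibbs.
apply: measurable_funB => //; apply: measurableT_comp; first exact: measurable_ln.
by apply: measurable_sum => b; exact: measurableT_comp.
Qed.

Lemma measurable_gibbs a : measurable_fun setT (fun z => gibbs (theta z) a).
Proof.
rewrite (_ : (fun z => _) = (fun z => expR (ln (gibbs (theta z) a)))).
  by apply: measurableT_comp => //; exact: measurable_ln_gibbs.
by apply/funext => z; rewrite lnK// posrE gibbs_gt0.
Qed.

Lemma measurable_kl_gibbs (x : Z -> E -> R) :
  (forall a, measurable_fun setT (fun z => x z a)) ->
  measurable_fun setT (fun z => kl (x z) (gibbs (theta z))).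
Proof.
move=> mx; apply: measurable_sum => a; apply: measurable_funM => //.
apply: measurableT_comp; first exact: measurable_ln.
(* As [gibbs] weights are positive, dividing by one is multiplying by [expR] of minus its logarithm,
   already known to be measurable. *)
rewrite (_ : (fun z => _) = (fun z => x z a * expR (- ln (gibbs (theta z) a)))).
  apply: measurable_funM => //; apply: measurableT_comp => //.
  by apply: measurable_funN; exact: measurable_ln_gibbs.
by apply/funext => z; rewrite expRN lnK// posrE gibbs_gt0.
Qed.

End MeasurableGibbs.

Section MeasurableAlgorithm.
Context {R : realType} {d : measure_display} {S : measurableType d}.
Context {I : finType} {A O : I -> finType} (M : openMDP R S A O).
Variables (theta0 : forall i : I, O i -> A i -> R) (eta B : R)
    (xstar : nat -> S -> pairs A -> R).
Hypothesis xstar_selection : comparator_selection M xstar.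
Local Notation T := (horizon M).
Local Notation policies := (@local_policies R I A O).

Lemma measurable_obs_comp d1 (Z : measurableType d1) (s : Z -> S) t i o :
  measurable_fun setT s -> measurable [set z | obs M t i (s z) = o].
Proof.
move=> ms; rewrite -[X in measurable X]setTI.
exact: (ms measurableT _ (measurable_obs M t o)).
Qed.

Lemma measurable_utility_comp d1 (Z : measurableType d1) (s : Z -> S) t X :
  measurable_fun setT s -> measurable_fun setT (fun z => utility M t X (s z)).
Proof. by move=> ms; exact: measurableT_comp (measurable_utility M t X) ms. Qed.

Lemma measurable_gain d1 (Z : measurableType d1) (s : Z -> S) t X i a :
  measurable_fun setT s -> measurable_fun setT (fun z => gain M t (s z) X (a : A i)).
Proof. by move=> ms; apply: measurable_funB; exact: measurable_utility_comp. Qed.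

Definition measurable_policies d1 (Z : measurableType d1) (theta : Z -> policies) :=
  forall i o a, measurable_fun setT (fun z => theta z i o a).

Lemma measurable_softmax d1 (Z : measurableType d1) (theta : Z -> policies) :
  measurable_policies theta -> measurable_policies (fun z => softmax (theta z)).
Proof. by move=> mt i o a; apply: measurable_gibbs => b; exact: mt. Qed.

Lemma measurable_observed d1 (Z : measurableType d1) (s : Z -> S)
    (theta : Z -> policies) t i a :
  measurable_fun setT s -> measurable_policies theta ->
  measurable_fun setT (fun z => theta z i (obs M t i (s z)) a).
Proof.
move=> ms mt.
apply: (measurable_fun_fin_index (F := fun o z => theta z i o a)) => o //.
exact: measurable_obs_comp.
Qed.

Lemma measurable_logit_update d1 (Z : measurableType d1) (s : Z -> S)
    (X : Z -> jaction A) (theta : Z -> policies) t :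
  measurable_fun setT s -> (forall Y, measurable [set z | X z = Y]) ->
  measurable_policies theta ->
  measurable_policies (fun z => logit_update M eta t (s z) (X z) (theta z)).
Proof.
move=> ms mX mt i o a; rewrite /logit_update.
apply: (measurable_fun_fin_index (g := fun z => obs M t i (s z)) (F := fun p z =>
  if (i \in active M t) && (o == p)
  then theta z i o a + eta * gain M t (s z) (X z) a else theta z i o a)) => [p|p].
  exact: measurable_obs_comp.
case: (_ && _); last exact: mt.
apply: measurable_funD; first exact: mt.
apply: measurable_funM => //.
apply: (measurable_fun_fin_index (F := fun Y z => gain M t (s z) Y a)) => Y //.
exact: measurable_gain.
Qed.

Lemma measurable_logits n t :
  measurable_policies (fun h : traj S A n =>
    logits M theta0 eta (state_at h) (action_at h) t).
Proof.
elim: t => [|t IH] i o a //=; rewrite /migrate.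
case: (boolP (i \in (active M t :&: active M t.+1)%SET)) => // _.
apply: measurable_logit_update => //; first exact: measurable_state_at.
by move=> Y; exact: measurable_action_at.
Qed.

Lemma measurable_xstar d1 (Z : measurableType d1) (s : Z -> S) t e :
  in_horizon M t -> tag e \in active M t -> measurable_fun setT s ->
  measurable_fun setT (fun z => xstar t (s z) e).
Proof.
move=> tT eD ms; have [_ mx] := xstar_selection tT.
have mxe : measurable_fun setT (fun s => xstar t s e) by apply: mx; rewrite inE.
exact: measurableT_comp mxe ms.
Qed.

Lemma measurable_kl_policies d1 (Z : measurableType d1) (s : Z -> S)
    (theta theta' : Z -> policies) t : in_horizon M t ->
  measurable_fun setT s -> measurable_policies theta -> measurable_policies theta' ->
  measurable_fun setT (fun z => kl_policies M t
    (comparator M xstar t (s z) (softmax (theta z))) (softmax (theta' z))).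
Proof.
move=> tT ms mt mt'.
apply: measurable_sum_cond => i iD; apply: measurable_sum => o.
apply: measurable_kl_gibbs => [a|a]; first exact: mt'.
apply: (measurable_fun_fin_index (g := fun z => obs M t i (s z)) (F := fun p z =>
  if o == p then xstar t (s z) (Tagged A a) else softmax (theta z) o a)) => p.
  exact: measurable_obs_comp.
case: (o == p); last exact: measurable_softmax.
exact: measurable_xstar.
Qed.

Lemma measurable_stage_gap d1 (Z : measurableType d1) (s : Z -> S)
    (theta : Z -> policies) t X : in_horizon M t ->
  measurable_fun setT s -> measurable_policies theta ->
  measurable_fun setT (fun z => stage_gap M B xstar t (s z) X (theta z)).
Proof.
move=> tT ms mt.
apply: measurable_funD => //; apply: measurable_funD.
  by apply: measurable_funM => //; exact: measurable_utility_comp.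
apply: measurable_sum_cond => i iD; apply: measurable_sum => a.
apply: measurable_funM; last exact: measurable_gain.
apply: measurable_funB.
  exact: measurable_xstar.
apply: (@measurable_observed _ Z s (fun z => softmax (theta z)) t i a ms).
exact: measurable_softmax.
Qed.

Lemma measurable_comparator_value d1 (Z : measurableType d1) (s : Z -> S) t :
  in_horizon M t -> measurable_fun setT s ->
  measurable_fun setT (fun z => comparator_value M xstar t (s z)).
Proof.
move=> tT ms; apply: measurable_sum_cond => X XJ; apply: measurable_funM.
  apply: measurable_prod_cond => e eX; apply: measurable_xstar => //.
  exact: selections_tag XJ eX.
exact: measurable_utility_comp.
Qed.

Lemma measurable_total_value n : measurable_fun setT
  (fun h : traj S A n => total_value M (state_at h) (action_at h)).
Proof.
apply: measurable_sum => t.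
apply: (measurable_fun_fin_index (F := fun X h => utility M t X (state_at h t))) => X.
  exact: measurable_action_at.
by apply: measurable_utility_comp; exact: measurable_state_at.
Qed.

(** Local policies may vary with the history, which covers both the fixed policies behind [Jstar]
    and the learned ones. *)
Lemma regular_factorized (P : forall n, traj S A n -> policies) :
  (forall n h i o, (n < T)%N -> i \in active M n.+1 ->
     (forall a, 0 <= P n h i o a) /\ \sum_(a : A i) P n h i o a = 1) ->
  (forall n, measurable_policies (P n)) ->
  regular_policy M (fun n h X => factorized M (P n h) n.+1 h.2 X).
Proof.
move=> P01 mP n nT; split=> [h X XJ|h|X].
- apply: prodr_ge0 => e eX.
  by apply: (P01 n h _ _ nT _).1; exact: selections_tag XJ eX.
- apply: (@sum_selections_prod _ _ _ _
    (fun e => P n h (tag e) (obs M n.+1 (tag e) h.2) (tagged e))) => i iD.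
  by have [_ <-] := P01 n h i (obs M n.+1 i h.2) nT iD.
- apply: measurable_prod_cond => e _.
  by apply: measurable_observed; [exact: measurable_snd|exact: mP].
Qed.

End MeasurableAlgorithm.

(** * Expectations under SubMAPL *)

Section Bounds.
Context {R : realType} {d : measure_display} {S : measurableType d}.
Context {I : finType} {A O : I -> finType} (M : openMDP R S A O).
Local Notation T := (horizon M).
Local Notation policies := (@local_policies R I A O).

Lemma regular_decentralized (pi : policies) :
  is_local_policies M pi -> regular_policy M (decentralized M pi).
Proof.
move=> hpi; apply: (regular_factorized (P := fun n h => pi)).
  by move=> n h i o nT iD; exact: (hpi n.+1).
by move=> n i o a; exact: measurable_cst.
Qed.

(** Trajectories holding inadmissible sets belong to the type but have probability 0; pathwise
    bounds valid only off such null sets are integrated through this lemma. *)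
Lemma law_ae_le q (Q : set (traj S A T)) (f g : traj S A T -> R) :
  regular_policy M q ->
  (forall h, 0 <= f h) -> (forall h, 0 <= g h) ->
  measurable_fun setT f -> measurable_fun setT g ->
  measurable Q -> law M q [set h | ~ Q h] = 0%E -> (forall h, Q h -> f h <= g h) ->
  (\int[law M q (n := T)]_h (f h)%:E <= \int[law M q (n := T)]_h (g h)%:E)%E.
Proof.
move=> hq f0 g0 mf mg mQ; have [mu <-] := law_probability hq (leqnn T) => muQ fg.
apply: ae_ge0_le_integral => //.
- by move=> h _; rewrite lee_fin.
- exact/measurable_EFinP.
- by move=> h _; rewrite lee_fin.
- exact/measurable_EFinP.
exists [set h | ~ Q h]; split => //; first exact: measurableC.
by move=> h /=; apply: contra_not => Qh _; rewrite lee_fin fg.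
Qed.

Lemma law_cst q (c : R) : regular_policy M q ->
  (\int[law M q (n := T)]_h c%:E = c%:E)%E.
Proof.
move=> hq; have [mu <-] := law_probability hq (leqnn T).
rewrite -[RHS]mule1 -[X in (_ * X)%E](probability_setT mu).
exact: (integral_cst mu measurableT).
Qed.

Lemma law_integralD q (f g : traj S A T -> R) : regular_policy M q ->
  (forall h, 0 <= f h) -> (forall h, 0 <= g h) ->
  measurable_fun setT f -> measurable_fun setT g ->
  (\int[law M q (n := T)]_h (f h + g h)%:E = \int[law M q (n := T)]_h (f h)%:E +
   \int[law M q (n := T)]_h (g h)%:E)%E.
Proof.
move=> hq f0 g0 mf mg; have [mu <-] := law_probability hq (leqnn T).
under eq_integral do rewrite EFinD.
rewrite ge0_integralD//.
- by move=> h _; rewrite lee_fin.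
- exact/measurable_EFinP.
- by move=> h _; rewrite lee_fin.
- exact/measurable_EFinP.
Qed.

Lemma law_integralZ q (f : traj S A T -> R) (c : R) : regular_policy M q ->
  (forall h, 0 <= f h) -> 0 <= c -> measurable_fun setT f ->
  (\int[law M q (n := T)]_h (c * f h)%:E =
   c%:E * \int[law M q (n := T)]_h (f h)%:E)%E.
Proof.
move=> hq f0 c0 mf; have [mu <-] := law_probability hq (leqnn T).
under eq_integral do rewrite EFinM.
rewrite ge0_integralZl_EFin//; last exact/measurable_EFinP.
by move=> h _; rewrite lee_fin.
Qed.

(** [fine] sends an infinite integral to 0, so identifying [expect] with the integral takes an a
    priori finite bound. *)
Lemma le_fine_integral q (f : traj S A T -> R) (c : R) : regular_policy M q ->
  (forall h, 0 <= f h) -> (\int[law M q (n := T)]_h (f h)%:E <= c%:E)%E ->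
  (\int[law M q (n := T)]_h (f h)%:E = (expect q f)%:E)%E.
Proof.
move=> hq f0; rewrite /expect; have [mu <-] := law_probability hq (leqnn T) => fc.
rewrite fineK// ge0_fin_numE ?(le_lt_trans fc) ?ltry//.
by apply: integral_ge0 => h _; rewrite lee_fin.
Qed.

Lemma measurable_admissible m :
  measurable [set h : traj S A m | admissible M (action_at h)].
Proof.
rewrite (_ : [set h | _] = \bigcap_(t in [set t | in_horizon M t])
    \bigcup_(X in [set X | X \in joint_actions M t])
      [set h : traj S A m | action_at h t = X]).
  apply: bigcap_measurable => [|t _].
    by exists 1%N => /=; rewrite /in_horizon horizon_gt0.
  by apply: fin_bigcup_measurable => [|X _]; [exact: finite_finset|exact: measurable_action_at].
apply/seteqP; split => h /= H t tT; first by exists (action_at h t) => //=; exact: H.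
by have [X /= XJ ->] := H t tT.
Qed.

Variables (theta0 : forall i : I, O i -> A i -> R) (eta B : R)
    (xstar : nat -> S -> pairs A -> R).
Hypotheses (eta_gt0 : 0 < eta)
    (utility_submodular : forall t s, in_horizon M t ->
      [/\ normalized (fun X => utility M t X s),
          monotone_on (ground M t) (fun X => utility M t X s) &
          submodular_on (ground M t) (fun X => utility M t X s)])
    (action_nonempty : forall t i, in_horizon M t -> i \in active M t ->
      (0 < #|A i|)%N)
    (marginal_bounded : forall t s (X : {set pairs A}) (e : pairs A),
      in_horizon M t -> X \subset ground M t -> e \in ground M t :\: X ->
      0 <= marginal (fun Y => utility M t Y s) e X <= B)
    (xstar_selection : comparator_selection M xstar).

Lemma regular_submapl : regular_policy M (submapl M theta0 eta).
Proof.
apply: (regular_factorized (P := fun n h => policy_at M theta0 eta h n.+1)).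
  move=> n h i o nT iD; split=> [a|]; first exact/ltW/gibbs_gt0.
  by apply: sum_gibbs; exact: (action_nonempty (t := n.+1)).
by move=> n; apply: measurable_softmax; exact: measurable_logits.
Qed.

Definition shifted_comparator n (h : traj S A n) : R := \sum_(1 <= t < n.+1)
  (comparator_value M xstar t (state_at h t) + gap_shift M B).

(** [stage_gap] is known to be nonnegative at admissible actions only. Clipping makes the integrand
    nonnegative on all trajectories and changes nothing on a set of full probability. *)
Definition clipped_gap n (h : traj S A n) : R := \sum_(1 <= t < n.+1)
  Num.max 0 (stage_gap M B xstar t (state_at h t) (action_at h t)
    (logits M theta0 eta (state_at h) (action_at h) t)).

Let gap_shift_ge0 : 0 <= gap_shift M B.
Proof. by rewrite mulr_ge0. Qed.

Lemma shifted_comparator_ge0 n (h : traj S A n) : (n <= T)%N ->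
  0 <= shifted_comparator h.
Proof.
move=> nT; rewrite /shifted_comparator big_nat sumr_ge0// => t /andP[t0 tn].
rewrite addr_ge0// comparator_value_ge0// /in_horizon t0.
by rewrite ltnS in tn; exact: leq_trans tn nT.
Qed.

Lemma measurable_shifted_comparator n : (n <= T)%N ->
  measurable_fun setT (@shifted_comparator n).
Proof.
move=> nT; rewrite /shifted_comparator; under eq_fun do rewrite big_nat.
apply: measurable_sum_cond => t /andP[t0 tn]; apply: measurable_funD => //.
apply: measurable_comparator_value => //; last exact: measurable_state_at.
by rewrite /in_horizon t0; exact: leq_trans nT.
Qed.

Lemma measurable_clipped_gap_term n (X : jaction A) t : in_horizon M t ->
  measurable_fun setT (fun h : traj S A n =>
    Num.max 0 (stage_gap M B xstar t (state_at h t) X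
      (logits M theta0 eta (state_at h) (action_at h) t))).
Proof.
move=> tT; apply: measurable_maxr => //.
apply: (measurable_stage_gap B xstar_selection X tT).
  exact: measurable_state_at.
exact: measurable_logits.
Qed.

Lemma measurable_clipped_gap n : (n <= T)%N ->
  measurable_fun setT (@clipped_gap n).
Proof.
move=> nT; rewrite /clipped_gap; under eq_fun do rewrite big_nat.
apply: measurable_sum_cond => t /andP[t0 tn].
apply: (measurable_fun_fin_index (F := fun X h =>
  Num.max 0 (stage_gap M B xstar t (state_at h t) X
    (logits M theta0 eta (state_at h) (action_at h) t)))) => X.
  exact: measurable_action_at.
apply: measurable_clipped_gap_term.
by rewrite /in_horizon t0; exact: leq_trans nT.
Qed.

Lemma logits_extend n (h : traj S A n) X s t : (t <= n.+1)%N ->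
  logits M theta0 eta (state_at (extend h X s)) (action_at (extend h X s)) t =
  logits M theta0 eta (state_at h) (action_at h) t.
Proof.
move=> tn; apply: eq_logits => k /andP[k0 kt].
  by rewrite state_at_extend// ltnW// (leq_trans kt).
by rewrite action_at_extend// k0 -ltnS (leq_trans kt).
Qed.

Lemma clipped_gap_extend n (h : traj S A n) X s :
  clipped_gap (extend h X s) = clipped_gap h +
  Num.max 0 (stage_gap M B xstar n.+1 h.2 X
    (logits M theta0 eta (state_at h) (action_at h) n.+1)).
Proof.
rewrite /clipped_gap big_nat_recr//; congr (_ + _).
  apply: eq_big_nat => t /andP[t0 tn].
  rewrite logits_extend; last exact: ltnW.
  by rewrite state_at_extend ?action_at_extend ?t0// ltnW.
rewrite logits_extend// state_at_extend// state_at_last.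
by rewrite action_at_extend_last.
Qed.

Lemma shifted_comparator_extend n (h : traj S A n) X s :
  shifted_comparator (extend h X s) = shifted_comparator h +
  (comparator_value M xstar n.+1 h.2 + gap_shift M B).
Proof.
rewrite /shifted_comparator big_nat_recr//=; congr (_ + _).
  by apply: eq_big_nat => t /andP[t0 tn]; rewrite state_at_extend// ltnW.
by rewrite state_at_extend// state_at_last.
Qed.

Lemma shifted_comparator_le_clipped_gap :
  (\int[law M (submapl M theta0 eta) (n := T)]_h (shifted_comparator h)%:E <=
   \int[law M (submapl M theta0 eta) (n := T)]_h (clipped_gap h)%:E)%E.
Proof.
apply: (stagewise_integral_le regular_submapl
  (f := fun n (h : traj S A n) => comparator_value M xstar n.+1 h.2 + gap_shift M B)
  (g := fun n (h : traj S A n) X => Num.max 0 (stage_gap M B xstar n.+1 h.2 X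
    (logits M theta0 eta (state_at h) (action_at h) n.+1)))).
- by move=> h; rewrite /shifted_comparator big_geq.
- by move=> *; exact: shifted_comparator_extend.
- by move=> *; exact: clipped_gap_extend.
- by move=> n h nT; rewrite addr_ge0// comparator_value_ge0.
- by move=> n h; exact: shifted_comparator_ge0.
- by move=> n h _; apply: sumr_ge0 => t _; rewrite le_max lexx.
- move=> n nT; apply: measurable_funD => //.
  by apply: measurable_comparator_value => //; exact: measurable_snd.
- move=> n X nT; apply: measurable_maxr => //.
  apply: (measurable_stage_gap B xstar_selection X (t := n.+1)) => //.
  exact: measurable_logits.
- by move=> n; exact: measurable_shifted_comparator.
- by move=> n; exact: measurable_clipped_gap.
move=> n h nT; apply: le_trans.
  exact: (expected_stage_gap_ge B utility_submodular action_nonempty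
    xstar_selection h.2 (logits M theta0 eta (state_at h) (action_at h) n.+1) (t := n.+1)).
apply: ler_sum => X XJ; apply: ler_wpM2l; last by rewrite le_max lexx orbT.
by have [+ _ _] := regular_submapl nT; exact.
Qed.

End Bounds.

Lemma measurable_value_bounds (R : realType) d (S : measurableType d) (I : finType)
    (A O : I -> finType) (M : openMDP R S A O) xstar W m :
  comparator_selection M xstar ->
  measurable [set h : traj S A m | [/\ admissible M (action_at h),
     total_value M (state_at h) (action_at h) <= W &
     W <= total_value M (state_at h) (action_at h) +
       \sum_(1 <= t < (horizon M).+1) comparator_value M xstar t (state_at h t)]].
Proof.
move=> hx.
pose tot (h : traj S A m) := total_value M (state_at h) (action_at h).
pose cmp (h : traj S A m) :=
  \sum_(1 <= t < (horizon M).+1) comparator_value M xstar t (state_at h t).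
have mtot : measurable_fun setT tot by exact: measurable_total_value.
have mcmp : measurable_fun setT cmp.
  rewrite /cmp; under eq_fun do rewrite big_nat.
  apply: measurable_sum_cond => t tT.
  by apply: measurable_comparator_value => //; exact: measurable_state_at.
rewrite (_ : [set h | _] = [set h | admissible M (action_at h)] `&`
  ([set h | tot h <= W] `&` [set h | W <= tot h + cmp h])); last first.
  apply/seteqP; split => h /= => [[adm le_W ge_W]|[adm [le_W ge_W]]].
    exact: conj adm (conj le_W ge_W).
  exact: And3 adm le_W ge_W.
apply: measurableI; first exact: measurable_admissible.
apply: measurableI.
  rewrite -[X in measurable X]setTI.
  by apply: (measurable_fun_le measurableT mtot); exact: measurable_cst.
rewrite -[X in measurable X]setTI.
apply: (measurable_fun_le (f := cst W) measurableT) => //.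
exact: measurable_funD.
Qed.

Theorem theorem2 (R : realType) (d : measure_display) (S : measurableType d)
    (I : finType) (A O : I -> finType) (M : openMDP R S A O)
    (theta0 : forall i : I, O i -> A i -> R) (eta B : R)
    (xstar : nat -> S -> pairs A -> R)
    (eta_gt0 : 0 < eta)
    (utility_submodular : forall t s, in_horizon M t ->
      [/\ normalized (fun X => utility M t X s),
          monotone_on (ground M t) (fun X => utility M t X s) &
          submodular_on (ground M t) (fun X => utility M t X s)])
    (action_nonempty : forall t i, in_horizon M t -> i \in active M t ->
      (0 < #|A i|)%N)
    (marginal_bounded : forall t s (X : {set pairs A}) (e : pairs A),
      in_horizon M t -> X \subset ground M t -> e \in ground M t :\: X ->
      0 <= marginal (fun Y => utility M t Y s) e X <= B)
    (time_expanded : time_expanded_utility M)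
    (xstar_selection : comparator_selection M xstar) :
  1 / 3 * Jstar M - 2 / 3 * tracking_cost M xstar theta0 eta B
    <= Jsubmapl M theta0 eta.
Proof.
have [W W0 feas] := time_expanded_value utility_submodular action_nonempty
  xstar_selection time_expanded.
set T := horizon M in feas *.
pose tot (h : traj S A T) := total_value M (state_at h) (action_at h).
pose var (h : traj S A T) :=
  kl_variation M theta0 eta xstar (state_at h) (action_at h).
have tot0 h : 0 <= tot h by apply: sumr_ge0 => t _; exact: utility_ge0.
have mtot : measurable_fun setT tot by exact: measurable_total_value.
pose Q := [set h : traj S A T | [/\ admissible M (action_at h), tot h <= W &
     W <= tot h + \sum_(1 <= t < T.+1) comparator_value M xstar t (state_at h t)]].
have mQ : measurable Q by exact: measurable_value_bounds.
have lawQ q : regular_policy M q -> law M q [set h | ~ Q h] = 0%E.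
  move=> hq; apply: (law_feasible hq _ feas) => m.
  exact: measurable_value_bounds.
have int_tot_le q : regular_policy M q ->
    (\int[law M q (n := T)]_h (tot h)%:E <= W%:E)%E.
  move=> hq; rewrite -(law_cst W hq).
  by apply: (law_ae_le hq (Q := Q)) => //; [exact: lawQ|move=> h []].
have int_tot q (hq : regular_policy M q) : (\int[law M q (n := T)]_h (tot h)%:E)%E =
    (expect q (@total_utility _ _ _ _ _ _ M))%:E.
  exact: le_fine_integral (int_tot_le q hq).
have Jstar_le : Jstar M <= W.
  (* An upper bound dominates [sup] only for a nonempty set of values; [softmax theta0] provides a
     member. *)
  apply: ge_sup.
    exists (J M (softmax theta0)); exists (softmax theta0) => // t i o tT iD.
    split=> [a|]; first exact/ltW/gibbs_gt0.
    by apply: sum_gibbs; exact: action_nonempty iD.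
  move=> _ [pi hpi <-]; have hq := regular_decentralized hpi.
  by rewrite -lee_fin -int_tot// int_tot_le.
have hq := regular_submapl theta0 eta action_nonempty.
set q := submapl M theta0 eta in hq.
pose K := @kl_bound R I A O (logit_bound M theta0 eta B).
have m_ps t : measurable_policies (fun h : traj S A T =>
    logits M theta0 eta (state_at h) (action_at h) t) by exact: measurable_logits.
have mvar : measurable_fun setT var.
  rewrite /var /kl_variation; under eq_fun do rewrite big_nat.
  apply: measurable_sum_cond => t /andP[t0 tT]; apply: measurable_maxr => //.
  apply: measurable_funB.
    by apply: (measurable_kl_policies xstar_selection) => //; exact: measurable_state_at.
  apply: (measurable_kl_policies xstar_selection) => //.
  - by rewrite /in_horizon t0 ltnW.
  - exact: measurable_state_at.
  - apply: measurable_logit_update => //; first exact: measurable_state_at.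
    by move=> Y; exact: measurable_action_at.
have T1 : in_horizon M 1 by rewrite /in_horizon horizon_gt0.
have mkl : measurable_fun setT (kl_start M theta0 xstar).
  apply: (measurable_kl_policies xstar_selection (theta := fun=> theta0)
    (theta' := fun=> theta0)) => //.
have kl0 s : 0 <= kl_start M theta0 xstar s by exact: kl_start_ge0.
have var0 h : 0 <= var h by exact: kl_variation_ge0.
have int_var : (\int[law M q (n := T)]_h (var h)%:E)%E =
    (tracking_variation M xstar theta0 eta)%:E.
  apply: (le_fine_integral (c := T%:R * K) hq) => //.
  rewrite -(law_cst (T%:R * K) hq); apply: (law_ae_le hq (Q := Q)) => //.
  - by move=> _; rewrite mulr_ge0// sumr_ge0// => i _; rewrite sumr_ge0// => o _; rewrite sumr_ge0.
  - exact: lawQ.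
  - by move=> h [adm _ _]; exact: kl_variation_le.
have int_kl : (\int[law M q (n := T)]_h (kl_start M theta0 xstar (state_at h 1))%:E)%E =
    (initial_divergence M xstar theta0)%:E.
  rewrite (integral_law_initial hq)// /initial_divergence /Rintegral fineK//.
  rewrite ge0_fin_numE; last by apply: integral_ge0 => s _; rewrite lee_fin; exact: kl0.
  apply: (@le_lt_trans _ _ (\int[init M]_s K%:E)%E).
    apply: ge0_le_integral => //.
    - by move=> s _; rewrite lee_fin; exact: kl0.
    - exact/measurable_EFinP.
    - by move=> s _; rewrite lee_fin; exact: kl_start_le.
  by rewrite integral_cst//= probability_setT mule1 ltry.
pose c := gap_shift M B; have c0 : 0 <= c by rewrite mulr_ge0.
pose C := eta * T%:R * (Nmax M)%:R * B ^+ 2 / 2 + T%:R * c.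
have C0 : 0 <= C.
  apply: addr_ge0; last exact: mulr_ge0.
  rewrite divr_ge0// mulr_ge0 ?sqr_ge0//.
  by rewrite mulr_ge0// mulr_ge0// ltW.
have shifted_ge0 h : 0 <= shifted_comparator M B xstar (h : traj S A T).
  exact: shifted_comparator_ge0.
(* The upper bound on [W] is integrated under SubMAPL, with the shift [c] added at each of the [T]
   stages on both sides. *)
have lower : ((W + T%:R * c)%:E <= \int[law M q (n := T)]_h (tot h)%:E +
    \int[law M q (n := T)]_h (clipped_gap M theta0 eta B xstar h)%:E)%E.
  apply: (@le_trans _ _ (\int[law M q (n := T)]_h (tot h)%:E +
    \int[law M q (n := T)]_h (shifted_comparator M B xstar h)%:E)%E); last first.
    by apply: leeD => //; exact: shifted_comparator_le_clipped_gap.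
  have mshift : measurable_fun setT (@shifted_comparator _ _ _ _ _ _ M B xstar T).
    exact: measurable_shifted_comparator.
  rewrite -(law_cst _ hq) -law_integralD//.
  apply: (law_ae_le hq (Q := Q)) => //.
  - by move=> _; rewrite addr_ge0// mulr_ge0.
  - by move=> h; rewrite addr_ge0.
  - exact: measurable_funD.
  - exact: lawQ.
  - move=> h [_ _ WQ]; rewrite /shifted_comparator big_split/= addrA lerD//.
    by rewrite sumr_const_nat subSS subn0 mulr_natl.
pose drift h : R := eta^-1 * (kl_start M theta0 xstar (state_at h 1) + var h).
have drift0 h : 0 <= drift h by rewrite mulr_ge0 ?addr_ge0// invr_ge0 ltW.
have mkl1 : measurable_fun setT
    (fun h : traj S A T => kl_start M theta0 xstar (state_at h 1)).
  by apply: measurableT_comp => //; exact: measurable_state_at.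
have mdrift : measurable_fun setT drift.
  by apply: measurable_funM => //; exact: measurable_funD.
(* On admissible trajectories clipping is inactive and [sum_stage_gap_le] applies; its right side
   integrates term by term. *)
have upper : (\int[law M q (n := T)]_h (clipped_gap M theta0 eta B xstar h)%:E <=
    (2 * Jsubmapl M theta0 eta + (initial_divergence M xstar theta0 +
      tracking_variation M xstar theta0 eta) / eta + C)%:E)%E.
  apply: (@le_trans _ _ (\int[law M q (n := T)]_h (2 * tot h + drift h + C)%:E)%E).
    apply: (law_ae_le hq (Q := Q)) => //.
    - by move=> h; apply: sumr_ge0 => t _; rewrite le_max lexx.
    - by move=> h; apply: addr_ge0 => //; apply: addr_ge0 => //; exact: mulr_ge0.
    - exact: measurable_clipped_gap.
    - apply: measurable_funD => //; apply: measurable_funD => //.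
      exact: measurable_funM.
    - exact: lawQ.
    - move=> h [adm _ _]; rewrite /drift [eta^-1 * _]mulrC.
      apply: le_trans (sum_stage_gap_le theta0 eta_gt0
        action_nonempty marginal_bounded xstar_selection (state_at h) adm).
      apply: ler_sum_nat => t tT; rewrite ge_max lexx andbT.
      by apply: stage_gap_ge0 => //; exact: adm.
  rewrite law_integralD//; last 2 first.
  - by move=> h; rewrite addr_ge0// mulr_ge0.
  - by apply: measurable_funD => //; exact: measurable_funM.
  rewrite law_integralD//; last 2 first.
  - by move=> h; rewrite mulr_ge0.
  - exact: measurable_funM.
  rewrite law_integralZ// law_integralZ ?invr_ge0//; last 3 first.
  - by move=> h; rewrite addr_ge0.
  - exact: ltW.
  - exact: measurable_funD.
  rewrite law_integralD// int_tot// int_kl int_var law_cst//.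
  by rewrite -!(EFinD, EFinM) [_ / eta]mulrC.
(* The shifts [T * c] cancel. What remains bounds [W], hence [Jstar M], by three times the SubMAPL
   value plus [D + eta * T * Nmax * B^2 / 2], which is [D] plus twice the second term of the
   tracking cost, while [D] is twice its first term. *)
have := le_trans lower (leeD (lexx _) upper).
rewrite int_tot// -EFinD lee_fin -/(Jsubmapl M theta0 eta) /C.
set L := _ + tracking_variation _ _ _ _.
have -> : tracking_cost M xstar theta0 eta B =
    L / eta / 2 + eta * T%:R * (Nmax M)%:R * B ^+ 2 / 4.
  by rewrite /tracking_cost invfM -/L mulrA mulrAC.
rewrite -/c; set D := L / eta; lra.
Qed.
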